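(* Let $\mathcal{P}=(P,\preceq)$ be a finite poset and consider a poset-causal system with data $(A,B,C,D,F)$ such that $(A_{ii},B_{ii})$ is stabilizable for all $i\in P$. For each $j\in P$ consider the Riccati equation associated with $\downarrow j$, which has a unique symmetric positive definite solution $X_j$, and let $(K(\downarrow j,\downarrow j),Q(j))=\mathrm{Ric}(\downarrow j)$ be the gain and transfer matrix obtained from $X_j$ (see context). Let $A_\Phi,B_\Phi,C_\Phi,C_Q,\Pi_1,\Pi_2$ be the matrices constructed from these gains and from the poset (see context). Then the optimal solution to the problem $$\underset{K}{\text{minimize}}\ \ \|P_{11}+P_{12}K(I-P_{22}K)^{-1}P_{21}\|^{2}\quad\text{subject to}\quad K\in\mathcal{I}(\mathcal{P}),\ K\text{ stabilizing}$$ is given by the controller $$K^{*}=\left[\begin{array}{c|c} A_\Phi-B_\Phi C_\Phi & B_\Phi\\ \hline C_Q(\Pi_2-\Pi_1C_\Phi) & C_Q\Pi_1\end{array}\right].$$ Moreover, $K^{*}\in\mathcal{I}(\mathcal{P})$ and $K^{*}$ is internally stabilizing.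
   Context: Poset notation. $P=\{1,\dots,p\}$, $\downarrow j=\{q\in P: j\preceq q\}$. Elements of $P$ are indexed along a linear extension ($i\preceq j$ implies $i\le j$), and sets $\downarrow j$ are listed in increasing order, so that $j$ comes first. Block matrices. All matrices are partitioned into blocks indexed by $P$; $M_{ij}$ is the $(i,j)$ block. A block matrix $M$ (real or transfer matrix) is in the (block) incidence algebra $\mathcal{I}(\mathcal{P})$ if $M_{ij}=0$ whenever $j\not\preceq i$. System. $\dot x=Ax+Fw+Bu$, $z=Cx+Du$, in continuous time, $x=(x_1,\dots,x_p)$, $x_i\in\mathbb{R}^{n_i}$, $u=(u_1,\dots,u_p)$, $u_i\in\mathbb{R}^{m_i}$, $z\in\mathbb{R}^l$; $A,B,F$ are partitioned into blocks, and $C=[C_j]$, $D=[D_j]$ into block columns. The system is poset-causal if $A,B\in\mathcal{I}(\mathcal{P})$. Standing assumptions: $C^TD=0$, $D^TD\succ0$, $F$ block diagonal with full column rank. The full state is available for feedback, $u=Kx$, and $P_{11}=C(sI-A)^{-1}F$, $P_{12}=C(sI-A)^{-1}B+D$, $P_{21}=(sI-A)^{-1}F$, $P_{22}=(sI-A)^{-1}B$. Controllers $K$ range over rational proper transfer matrices; $K$ is (internally) stabilizing if the state matrix of the closed-loop interconnection of the plant with (a realization of) $K$ is stable. $\|\cdot\|$ is the $\mathcal{H}_2$ norm. The notation $\left[\begin{array}{c|c}\mathcal{A}&\mathcal{B}\\ \hline \mathcal{C}&\mathcal{D}\end{array}\right]$ means $\mathcal{C}(sI-\mathcal{A})^{-1}\mathcal{B}+\mathcal{D}$.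 Submatrices. $M(\downarrow j)$ consists of the block columns of $M$ indexed by $\downarrow j$; $M(\downarrow j,\downarrow j)=[M_{kl}]_{k,l\in\downarrow j}$. $E_i$ denotes a tall block matrix with an identity in the $i$-th block row and zeros elsewhere. Riccati equations and gains. For $j\in P$ put $A_j=A(\downarrow j,\downarrow j)$, $B_j=B(\downarrow j,\downarrow j)$, $C_j'=C(\downarrow j)$, $D_j'=D(\downarrow j)$. The Riccati equation associated with $\downarrow j$ is $$A_j^TX_j+X_jA_j-X_jB_j(D_j'^TD_j')^{-1}B_j^TX_j+C_j'^TC_j'=0.$$ With $X_j$ its unique symmetric positive definite solution, $\mathrm{Ric}(\downarrow j)$ denotes the pair $(K(\downarrow j,\downarrow j),Q(j))$ with $$K(\downarrow j,\downarrow j)=(D_j'^TD_j')^{-1}B_j^TX_j,\qquad Q(j)=\left[\begin{array}{c|c}A_j-B_jK(\downarrow j,\downarrow j)&E_1F_{jj}\\ \hline -K(\downarrow j,\downarrow j)&0\end{array}\right],$$ where $K(\downarrow j,\downarrow j)$ is a block matrix with rows and columns indexed by $\downarrow j$ and $E_1$ here has $|\downarrow j|$ block rows. Constructed matrices. $\mathbf{A}=\mathrm{diag}_{j\in P}\big(A(\downarrow j,\downarrow j)-B(\downarrow j,\downarrow j)K(\downarrow j,\downarrow j)\big)$, $\mathbf{K}=\mathrm{diag}_{j\in P}\big(K(\downarrow j,\downarrow j)\big)$ (block diagonal, $j=1,\dots,p$). $\Pi_1$ is block diagonal with $j$-th diagonal block $E_1$ having $|\downarrow j|$ block rows, i.e.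 the $(\sum_{k\in\downarrow j}n_k)\times n_j$ matrix with identity in the first $n_j$ rows and zeros below. $\Pi_2$ is block diagonal with $j$-th diagonal block $[E_2\ \cdots\ E_{|\downarrow j|}]$ with $|\downarrow j|$ block rows (the remaining columns of the identity of size $\sum_{k\in\downarrow j}n_k$; it has no columns if $\downarrow j=\{j\}$). For $S\subseteq P$, $E_S=[E_i]_{i\in S}$ with block rows indexed by $P$; $R=[E_{\downarrow 1}\ \cdots\ E_{\downarrow p}]$. Then $$A_\Phi=\Pi_2^T\mathbf{A}\Pi_2,\quad B_\Phi=\Pi_2^T\mathbf{A}\Pi_1,\quad C_\Phi=R\Pi_2,\quad C_Q=-R\mathbf{K},$$ where the blocks of $R$ have state dimensions $n_i$ in $C_\Phi$ and input dimensions $m_i$ in $C_Q$ (the same symbol is used for both).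
   Formalization: Existence of the positive definite Riccati solutions X_j is assumed, as it does not follow from the listed hypotheses (A=-1, B=D=F=1, C=0 has none); their uniqueness is proved. ''Optimal'' means feasible with minimal cost; uniqueness of K, false for non-square F, is not claimed. *)

(* Defs.v *)
From HB Require Import structures.
From mathcomp Require Import all_boot all_order all_algebra.
From mathcomp Require Import complex.
From mathcomp Require Import all_classical all_reals all_analysis.

Set Implicit Arguments.
Unset Strict Implicit.
Unset Printing Implicit Defensive.

Import Order.TTheory GRing.Theory Num.Theory.
Local Open Scope ring_scope.

Section Matrices.
Context {R : realType}.

(* Continuous-time stability: the complex spectrum lies in the open left
   half-plane. *)
Definition hurwitz (n : nat) (A : 'M[R]_n) : Prop :=
  forall z : R[i],
    eigenvalue (map_mx (real_complex R) A) z -> complex.Re z < 0.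

Definition stabilizable (n m : nat) (A : 'M[R]_n) (B : 'M[R]_(n, m)) : Prop :=
  exists K : 'M[R]_(m, n), hurwitz (A + B *m K).

Definition posdef (n : nat) (M : 'M[R]_n) : Prop :=
  M^T = M /\
  forall x : 'cV[R]_n, x != 0 -> 0 < (x^T *m M *m x) ord0 ord0.

End Matrices.

(* Real-rational transfer matrices are matrices over the field R(s). *)
Section TransferMatrices.
Context {R : realType}.

Local Notation ratfun := {fraction {poly R}}.

Definition ratcst : R -> ratfun := @FracField.tofrac {poly R} \o polyC.

Definition ratvar : ratfun := FracField.tofrac 'X.

Definition cstmx (m n : nat) (M : 'M[R]_(m, n)) : 'M[ratfun]_(m, n) :=
  map_mx ratcst M.

Definition ss_tf (k m n : nat) (A : 'M[R]_k) (B : 'M[R]_(k, n))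
    (C : 'M[R]_(m, k)) (D : 'M[R]_(m, n)) : 'M[ratfun]_(m, n) :=
  cstmx C *m invmx (ratvar%:M - cstmx A) *m cstmx B + cstmx D.

Definition proper_tf (m n : nat) (G : 'M[ratfun]_(m, n)) : Prop :=
  forall i j, exists a b : {poly R},
    [/\ b != 0, (size a <= size b)%N
      & G i j = FracField.tofrac a / FracField.tofrac b].

(* The value at z of the reduced form of f; it is 0 at the poles of f. *)
Definition rateval (f : ratfun) (z : R[i]) : R[i] :=
  let a := (fraction.frac (generic_quotient.repr f)).1 in
  let b := (fraction.frac (generic_quotient.repr f)).2 in
  let ev (q : {poly R}) := (map_poly (real_complex R) q).[z] in
  ev (a %/ gcdp a b)%R / ev (b %/ gcdp a b)%R.

Definition tfeval (m n : nat) (G : 'M[ratfun]_(m, n)) (z : R[i]) :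
    'M[R[i]]_(m, n) :=
  map_mx (rateval^~ z) G.

(* The squared H2 norm
     1/(2 pi) * \int_(-oo)^(+oo) tr (G(iw)^* G(iw)) dw
   of a stable transfer matrix G, with value +oo when the integral diverges. *)
Definition h2norm_sq (m n : nat) (G : 'M[ratfun]_(m, n)) : \bar R :=
  ((2 * pi)^-1)%:E *
  \int[@lebesgue_measure R]_(w in [set: R])
    (complex.Re (\tr ((map_mx Num.conj (tfeval G (Complex 0 w)))^T
                        *m tfeval G (Complex 0 w))))%:E.

End TransferMatrices.

Section StateFeedback.
Context {R : realType} {nx nu nw l : nat}.
Variables (A : 'M[R]_nx) (B : 'M[R]_(nx, nu)) (C : 'M[R]_(l, nx))
  (D : 'M[R]_(l, nu)) (F : 'M[R]_(nx, nw)).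

Local Notation ratfun := {fraction {poly R}}.

Definition P11 : 'M[ratfun]_(l, nw) := ss_tf A F C 0.
Definition P12 : 'M[ratfun]_(l, nu) := ss_tf A B C D.
Definition P21 : 'M[ratfun]_(nx, nw) := ss_tf A F 1%:M 0.
Definition P22 : 'M[ratfun]_(nx, nu) := ss_tf A B 1%:M 0.

Definition closed_loop (K : 'M[ratfun]_(nu, nx)) : 'M[ratfun]_(l, nw) :=
  P11 + P12 *m K *m invmx (1%:M - P22 *m K) *m P21.

(* For some realization xi' = Ak xi + Bk x, u = Ck xi + Dk x of K, the state
   matrix of the interconnection with x' = A x + B u is stable.  (Existential,
   since a realization with hidden unstable modes is never stabilized.) *)
Definition stabilizing (K : 'M[ratfun]_(nu, nx)) : Prop :=
  exists (k : nat) (Ak : 'M[R]_k) (Bk : 'M[R]_(k, nx))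
         (Ck : 'M[R]_(nu, k)) (Dk : 'M[R]_(nu, nx)),
    K = ss_tf Ak Bk Ck Dk /\
    hurwitz (block_mx (A + B *m Dk) (B *m Ck) Bk Ak).

End StateFeedback.

(* The poset is ['I_p] with an order [le] of which the usual order of ['I_p]
   is a linear extension. *)
Definition poset_on (p : nat) (le : rel 'I_p) : Prop :=
  [/\ reflexive le, antisymmetric le, transitive le
    & forall i j : 'I_p, le i j -> (i <= j)%N].

Section BlockMatrices.
Context {p : nat}.

Definition block_diagonal (T : nmodType) (r c : 'I_p -> nat)
    (M : 'M[T]_(\sum_i r i, \sum_j c j)) : Prop :=
  forall i j, i != j -> submxblock M i j = 0.

(* \mxdiag with rectangular diagonal blocks *)
Definition bdiag (T : nmodType) (r c : 'I_p -> nat)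
    (M : forall j, 'M[T]_(r j, c j)) : 'M[T]_(\sum_i r i, \sum_j c j) :=
  \mxblock_(i < p, j < p) (if i == j then conform_mx 0 (M i) else 0).

Variable le : rel 'I_p.

Definition incidence (T : nmodType) (r c : 'I_p -> nat)
    (M : 'M[T]_(\sum_i r i, \sum_j c j)) : Prop :=
  forall i j, ~~ le j i -> submxblock M i j = 0.

Definition downset (j : 'I_p) : {set 'I_p} := [set q | le j q].

(* The elements of [downset j] in increasing order, so that [dn j 0] is j. *)
Definition dn (j : 'I_p) (k : 'I_#|downset j|) : 'I_p := enum_val k.

Definition ddim (d : 'I_p -> nat) (j : 'I_p) : nat :=
  (\sum_(k < #|downset j|) d (dn k))%N.

Definition down_cols (T : nmodType) (l : nat) (c : 'I_p -> nat)
    (M : 'M[T]_(l, \sum_j c j)) (j : 'I_p) : 'M[T]_(l, ddim c j) :=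
  \mxrow_(k < #|downset j|) submxrow M (dn k).

Definition down_block (T : nmodType) (r c : 'I_p -> nat)
    (M : 'M[T]_(\sum_i r i, \sum_j c j)) (j : 'I_p) :
    'M[T]_(ddim r j, ddim c j) :=
  \mxblock_(k < #|downset j|, q < #|downset j|) submxblock M (dn k) (dn q).

Variable T : pzRingType.

Definition tallE (d : 'I_p -> nat) (i : 'I_p) : 'M[T]_(\sum_k d k, d i) :=
  \mxcol_(k < p) (if k == i then pid_mx (d i) else 0).

Definition Rmx (d : 'I_p -> nat) : 'M[T]_(\sum_i d i, \sum_j ddim d j) :=
  \mxrow_(j < p) \mxrow_(k < #|downset j|) tallE d (dn k).

Definition Pi1 (d : 'I_p -> nat) : 'M[T]_(\sum_j ddim d j, \sum_j d j) :=
  bdiag (fun j => pid_mx (d j) : 'M[T]_(ddim d j, d j)).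

(* The j-th diagonal block consists of the columns d j, d j + 1, ... of the
   identity matrix of size [ddim d j]. *)
Definition Pi2 (d : 'I_p -> nat) :
    'M[T]_(\sum_j ddim d j, \sum_j (ddim d j - d j)) :=
  bdiag (fun j => \matrix_(a < ddim d j, b < ddim d j - d j)
                    ((a == d j + b :> nat)%N)%:R).

End BlockMatrices.

Section PosetController.
Context {R : realType} {p : nat}.
Variables (le : rel 'I_p) (n m : 'I_p -> nat) (l : nat).
Variables (A : 'M[R]_(\sum_i n i)) (B : 'M[R]_(\sum_i n i, \sum_i m i))
  (C : 'M[R]_(l, \sum_i n i)) (D : 'M[R]_(l, \sum_i m i)).

Local Notation Ad j := (down_block le A j).
Local Notation Bd j := (down_block le B j).
Local Notation Cd j := (down_cols le C j).
Local Notation Dd j := (down_cols le D j).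

Definition riccati_solution (j : 'I_p) (X : 'M[R]_(ddim le n j)) : Prop :=
  (Ad j)^T *m X + X *m Ad j
    - X *m Bd j *m invmx ((Dd j)^T *m Dd j) *m (Bd j)^T *m X
    + (Cd j)^T *m Cd j = 0.

Variable X : forall j : 'I_p, 'M[R]_(ddim le n j).

Definition ric_gain (j : 'I_p) : 'M[R]_(ddim le m j, ddim le n j) :=
  invmx ((Dd j)^T *m Dd j) *m (Bd j)^T *m X j.

Definition boldA : 'M[R]_(\sum_j ddim le n j) :=
  bdiag (fun j => Ad j - Bd j *m ric_gain j).

Definition boldK : 'M[R]_(\sum_j ddim le m j, \sum_j ddim le n j) :=
  bdiag ric_gain.

Local Notation Pi1 := (Pi1 le R n).
Local Notation Pi2 := (Pi2 le R n).

Definition A_Phi := Pi2^T *m boldA *m Pi2.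
Definition B_Phi := Pi2^T *m boldA *m Pi1.
Definition C_Phi := Rmx le R n *m Pi2.
Definition C_Q := - Rmx le R m *m boldK.

Definition Kstar : 'M[{fraction {poly R}}]_(\sum_i m i, \sum_i n i) :=
  ss_tf (A_Phi - B_Phi *m C_Phi) B_Phi
        (C_Q *m (Pi2 - Pi1 *m C_Phi)) (C_Q *m Pi1).

End PosetController.

(* Main.v *)
Require Import Defs.
From HB Require Import structures.
From mathcomp Require Import all_boot all_order all_algebra.
From mathcomp Require Import complex ring lra.
From mathcomp Require Import all_classical all_reals all_analysis.
From mathcomp Require Import measurable_realfun.

Set Implicit Arguments.
Unset Strict Implicit.
Unset Printing Implicit Defensive.

Import Order.TTheory GRing.Theory Num.Theory.
Local Open Scope ring_scope.

(** Why the controller is optimal.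

    A controller [K] enters the closed loop only through the responses
    [S = (s - A - B K)^-1 F] of the state and [U = K S] of the input, because the
    closed loop is [C S + D U] ([closed_loop_resp]).  If [K] is in the incidence
    algebra then so are [S] and [U] ([incidence_invmx]).  As [F] is block diagonal,
    the [j]-th block columns [S_j] and [U_j] live on the downset of [j], where
    [s S_j = A_j S_j + F_j + B_j U_j] ([s_down_state]).  The cost is thus a sum of
    costs of centralized state-feedback problems, one for each downset; what couples
    them is only that all columns come from one controller.

    With the Riccati solution [X_j], the gain [K_j] and [N_j = U_j + K_j S_j],
    completing the square on the imaginary axis gives ([lqr_identity])
    [|C_j S_j + D_j U_j|^2 = tr (N_j^* D_j^T D_j N_j) + 2 Re tr (F_j^T X_j S_j)].
    The first term is nonnegative, and zero for the controller of the theorem, whose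
    responses are copies of those of the local loops [A_j - B_j K_j]
    ([state_resp_tallE]).  The second term contributes the same amount for every
    stabilizing controller: the difference [S - S'] of two responses satisfies the
    plant equation without disturbance, so [s (S - S')] is still strictly proper, and
    a stable rational function of relative degree at least two has mean zero on the
    imaginary axis ([sps_zero_mean]).  That fact is the vanishing of a contour
    integral; here it comes from partial fractions, which provide an antiderivative
    that tends to zero at both ends of the axis ([zero_mean_ratio]).  The two
    costs are compared on bounded intervals before passing to the limit
    ([le_integral_zero_mean]).

    The local loops are stable by a Lyapunov argument ([care_hurwitz]), for which the
    stabilizability of the diagonal blocks is carried over to the downsets with the
    Hautus test ([pbh_down_block]).  The state matrix of plant and controller is
    similar to the direct sum of the local loops ([loop_similar]), so the controller
    is internally stabilizing.  It is in the incidence algebra because it is the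
    quotient of two responses that are ([incidence_of_invmx]).  Finally, the Riccati
    solution is unique because the difference of two solutions solves a homogeneous
    Sylvester equation between stable matrices ([sylvester_hurwitz]). *)

(** * Blocks as injections *)

Section BlockInjections.
Variables (T : pzRingType) (p : nat).
Implicit Types (d r c : 'I_p -> nat).

Lemma pid_mx_square n : pid_mx n = 1%:M :> 'M[T]_n.
Proof. by apply/matrixP=> i j; rewrite !mxE ltn_ord andbT. Qed.

Lemma tallE_tr_mxcol d k (M : forall i, 'M[T]_(d i, k)) i :
  (tallE T d i)^T *m (\mxcol_j M j) = M i.
Proof.
rewrite /tallE tr_mxcol mul_mxrow_mxcol (bigD1 i) //= eqxx pid_mx_square trmx1.
rewrite mul1mx big1 ?addr0 // => j /negbTE nji.
by rewrite nji trmx0 mul0mx.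
Qed.

Lemma mxrow_tallE c k (M : forall i, 'M[T]_(k, c i)) i :
  (\mxrow_j M j) *m tallE T c i = M i.
Proof.
rewrite /tallE mul_mxrow_mxcol (bigD1 i) //= eqxx pid_mx_square.
rewrite mulmx1 big1 ?addr0 // => j /negbTE nji.
by rewrite nji mulmx0.
Qed.

(** This turns statements on blocks into identities between products with the
    injections [tallE]. *)
Lemma submxblock_tallE r c (M : 'M[T]_(\sum_i r i, \sum_j c j)) i j :
  submxblock M i j = (tallE T r i)^T *m M *m tallE T c j.
Proof.
rewrite -mulmxA -{2}[M]submxrowK mxrow_tallE.
by rewrite -[submxrow M j]submxcolK tallE_tr_mxcol submxblockEh.
Qed.

Lemma tallE_orth d i j : i != j -> (tallE T d i)^T *m tallE T d j = 0.
Proof. by move=> /negbTE nij; rewrite tallE_tr_mxcol nij. Qed.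

Lemma tallE_tr_id d i : (tallE T d i)^T *m tallE T d i = 1%:M.
Proof. by rewrite tallE_tr_mxcol eqxx pid_mx_square. Qed.

Lemma sum_tallE d : \sum_i tallE T d i *m (tallE T d i)^T = 1%:M.
Proof.
apply/mxblockP => i j; rewrite submxblock_sum submxblock_tallE mulmx1.
rewrite (bigD1 i) //= submxblock_tallE mulmxA tallE_tr_id mul1mx.
rewrite [X in _ + X]big1 ?addr0 // => k nki; rewrite submxblock_tallE mulmxA.
by rewrite tallE_orth 1?eq_sym // !mul0mx.
Qed.

Lemma eq_by_tallE c k (M N : 'M[T]_(k, \sum_i c i)) :
  (forall i, M *m tallE T c i = N *m tallE T c i) -> M = N.
Proof.
move=> eqMN; rewrite -[M]mulmx1 -[N]mulmx1 -sum_tallE !mulmx_sumr.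
by apply: eq_bigr => i _; rewrite !mulmxA eqMN.
Qed.

Lemma eq_by_tallE_tr d k (M N : 'M[T]_(\sum_i d i, k)) :
  (forall i, (tallE T d i)^T *m M = (tallE T d i)^T *m N) -> M = N.
Proof.
move=> eqMN; rewrite -[M]mul1mx -[N]mul1mx -sum_tallE !mulmx_suml.
by apply: eq_bigr => i _; rewrite -!mulmxA eqMN.
Qed.

Lemma mul_bdiag_tallE r c (M : forall j, 'M[T]_(r j, c j)) j :
  bdiag M *m tallE T c j = tallE T r j *m M j.
Proof.
apply: eq_by_tallE_tr => i; rewrite mulmxA -submxblock_tallE mxblockK mulmxA.
case: eqVneq => [->|nij]; last by rewrite tallE_orth // mul0mx.
by rewrite conform_mx_id tallE_tr_id mul1mx.
Qed.

Lemma mul_tallE_tr_bdiag r c (M : forall j, 'M[T]_(r j, c j)) j :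
  (tallE T r j)^T *m bdiag M = M j *m (tallE T c j)^T.
Proof.
apply: eq_by_tallE => i; rewrite -submxblock_tallE mxblockK -mulmxA.
case: eqVneq => [->|nij]; last by rewrite tallE_orth // mulmx0.
by rewrite conform_mx_id tallE_tr_id mulmx1.
Qed.

Lemma block_diagonal_tallE r c (M : 'M[T]_(\sum_i r i, \sum_j c j)) j :
  block_diagonal M -> M *m tallE T c j = tallE T r j *m submxblock M j j.
Proof.
move=> Mdiag; apply: eq_by_tallE_tr => i; rewrite mulmxA -submxblock_tallE mulmxA.
have [->|nij] := eqVneq i j; first by rewrite tallE_tr_id mul1mx.
by rewrite tallE_orth // mul0mx Mdiag.
Qed.

End BlockInjections.

Lemma map_tallE (T T' : pzRingType) (f : {rmorphism T -> T'}) (p : nat)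
    (d : 'I_p -> nat) i :
  map_mx f (tallE T d i) = tallE T' d i.
Proof.
apply/matrixP => a b; rewrite !mxE; case: ifP => _; rewrite !mxE ?rmorph0 //.
by rewrite rmorph_nat.
Qed.

(** * Downsets and the incidence algebra *)

Section Downsets.
Variables (T : comPzRingType) (p : nat) (le : rel 'I_p).
Implicit Types (d r c : 'I_p -> nat).

(** The inclusion of the blocks of [downset le j] into all the blocks: every
    restriction to a downset is a product with this matrix. *)
Definition downE d (j : 'I_p) : 'M[T]_(\sum_i d i, ddim le d j) :=
  \mxrow_(k < #|downset le j|) tallE T d (dn k).

Lemma dnP j k : le j k -> exists q : 'I_#|downset le j|, dn q = k.
Proof.
move=> jk; have kd : k \in downset le j by rewrite inE.
by exists (enum_rank_in kd k); rewrite /dn enum_rankK_in.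
Qed.

Lemma le_dn j (q : 'I_#|downset le j|) : le j (dn q).
Proof. by have := enum_valP q; rewrite inE. Qed.

Lemma downE_tr_id d j : (downE d j)^T *m downE d j = 1%:M.
Proof.
rewrite /downE tr_mxrow mul_mxcol_mxrow.
apply/mxblockP => a b; rewrite mxblockK submxblock_tallE mulmx1.
have [->|nab] := eqVneq a b; first by rewrite !tallE_tr_id.
by rewrite !tallE_orth //; apply: contraNneq nab => /enum_val_inj ->.
Qed.

Lemma downE_proj d j k : le j k ->
  downE d j *m ((downE d j)^T *m tallE T d k) = tallE T d k.
Proof.
case/dnP=> q <-; rewrite -(@mxrow_tallE T _ _ _ (fun q => tallE T d (dn q)) q).
by rewrite -/(downE d j) (mulmxA _^T) downE_tr_id mul1mx.
Qed.

Lemma tallE_tr_downE d j k : ~~ le j k -> (tallE T d k)^T *m downE d j = 0.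
Proof.
move=> njk; rewrite /downE mul_mxrow -[RHS]mxrow0; apply: eq_mxrow => q.
by rewrite tallE_orth //; apply: contraNneq njk => ->; apply: le_dn.
Qed.

Lemma down_colsE l c (M : 'M[T]_(l, \sum_j c j)) j :
  down_cols le M j = M *m downE c j.
Proof.
rewrite /downE mul_mxrow; apply: eq_mxrow => q.
by rewrite -{2}[M]submxrowK mxrow_tallE.
Qed.

Lemma down_blockE r c (M : 'M[T]_(\sum_i r i, \sum_j c j)) j :
  down_block le M j = (downE r j)^T *m M *m downE c j.
Proof.
rewrite {2}/downE mul_mxrow /downE tr_mxrow /down_block mxblockEh.
apply: eq_mxrow => q; rewrite -mulmxA mxcol_mul; apply: eq_mxcol => k.
by rewrite submxblock_tallE mulmxA.
Qed.

Lemma Rmx_tallE d j : Rmx le T d *m tallE T (ddim le d) j = downE d j.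
Proof. by rewrite /Rmx mxrow_tallE. Qed.

Hypothesis le_poset : poset_on le.

(** By transitivity the blocks of a downset span a subspace that every element
    of the incidence algebra leaves invariant. *)
Lemma incidence_downE r c (M : 'M[T]_(\sum_i r i, \sum_j c j)) j :
  incidence le M -> M *m downE c j = downE r j *m down_block le M j.
Proof.
case: le_poset => _ _ tr_le _ Minc; apply: eq_by_tallE_tr => i.
rewrite down_blockE !mulmxA; have [ji|nji] := boolP (le j i).
  by have /(congr1 trmx) := downE_proj r ji; rewrite !trmx_mul trmxK => ->.
rewrite tallE_tr_downE // !mul0mx /downE mul_mxrow -[RHS]mxrow0.
apply: eq_mxrow => q; rewrite -submxblock_tallE Minc //.
by apply: contra nji; apply: tr_le (le_dn q).
Qed.

Lemma incidenceP r c (M : 'M[T]_(\sum_i r i, \sum_j c j)) :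
  (forall j, exists N, M *m tallE T c j = downE r j *m N) -> incidence le M.
Proof.
move=> MN i j nji; have [N eqMN] := MN j.
by rewrite submxblock_tallE -mulmxA eqMN mulmxA tallE_tr_downE // mul0mx.
Qed.

Lemma incidence_tallE r c (M : 'M[T]_(\sum_i r i, \sum_j c j)) j :
  incidence le M ->
  M *m tallE T c j = downE r j *m ((downE r j)^T *m (M *m tallE T c j)).
Proof.
case: le_poset => le_refl _ _ _ Minc; rewrite -(downE_proj c (le_refl j)).
rewrite !(mulmxA M) incidence_downE // -!mulmxA.
by rewrite [(downE r j)^T *m (downE r j *m _)]mulmxA downE_tr_id mul1mx.
Qed.

Lemma incidence_mul r k c (M : 'M[T]_(\sum_i r i, \sum_i k i))
    (N : 'M[T]_(\sum_i k i, \sum_j c j)) :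
  incidence le M -> incidence le N -> incidence le (M *m N).
Proof.
move=> Minc Ninc; apply: incidenceP => j.
rewrite -mulmxA (incidence_tallE j Ninc) mulmxA incidence_downE // -mulmxA.
by eexists.
Qed.

End Downsets.

Lemma map_downE (T T' : comPzRingType) (f : {rmorphism T -> T'}) (p : nat)
    (le : rel 'I_p) (d : 'I_p -> nat) j :
  map_mx f (downE T le d j) = downE T' le d j.
Proof.
apply/mxrowP => q; rewrite mxrowK -(map_tallE f).
rewrite -[tallE T d (dn q)](mxrowK (fun q => tallE T d (dn q))).
by apply/matrixP => a b; rewrite !mxE.
Qed.

(** The blocks of an invertible element of the incidence algebra on a downset
    form an invertible matrix, since the downset spans an invariant subspace;
    so the inverse leaves this subspace invariant too. *)
Lemma incidence_invmx (K : fieldType) (p : nat) (le : rel 'I_p)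
    (d : 'I_p -> nat) (M : 'M[K]_(\sum_i d i)) :
  poset_on le -> M \in unitmx -> incidence le M -> incidence le (invmx M).
Proof.
move=> le_poset Mu Minc; apply: incidenceP => j.
have [le_refl _ _ _] := le_poset.
pose E := downE K le d j; pose Mj := down_block le M j.
have invM : invmx M *m E *m Mj = E.
  by rewrite -mulmxA -incidence_downE // mulmxA mulVmx // mul1mx.
have Mju : Mj \in unitmx.
  suff /mulmx1_unit[] : (E^T *m invmx M *m E) *m Mj = 1%:M by [].
  by rewrite -2!mulmxA (mulmxA _ E) invM downE_tr_id.
exists (invmx Mj *m (E^T *m tallE K d j)).
have EMj : invmx M *m E = E *m invmx Mj by rewrite -{2}invM mulmxK.
by rewrite -{1}(downE_proj K d (le_refl j)) -/E (mulmxA (invmx M)) EMj -mulmxA.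
Qed.

(** The form in which a controller is recovered from its two closed-loop
    responses. *)
Lemma incidence_of_invmx (K : fieldType) (p : nat) (le : rel 'I_p)
    (r d : 'I_p -> nat) (M : 'M[K]_(\sum_i r i, \sum_i d i)) (L : 'M[K]_(\sum_i d i)) :
  poset_on le -> L \in unitmx ->
  incidence le (invmx L) -> incidence le (M *m invmx L) -> incidence le M.
Proof.
move=> le_poset Lu Linc Minc.
have -> : M = (M *m invmx L) *m invmx (invmx L) by rewrite invmxK mulmxKV.
apply: (incidence_mul le_poset Minc); apply: incidence_invmx => //.
by rewrite unitmx_inv.
Qed.

(** * Splitting a downset into its first block and the others *)

Section TailColumns.
Variable T : comPzRingType.

Definition tail_mx N d r : 'M[T]_(N, r) :=
  \matrix_(a < N, b < r) ((a == d + b :> nat)%N)%:R.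

Lemma tail_mx_col d r : tail_mx (d + r) d r = col_mx 0 1%:M.
Proof.
apply/matrixP => a b; rewrite mxE; case: (split_ordP a) => k ->.
  by rewrite col_mxEu mxE /= ltn_eqF // ltn_addr.
by rewrite col_mxEd mxE /= eqn_add2l.
Qed.

(** Both matrices are block columns of one identity matrix. *)
Lemma pid_tail_mx N d r : N = (d + r)%N ->
  [/\ (pid_mx d : 'M[T]_(N, d))^T *m (pid_mx d : 'M[T]_(N, d)) = 1%:M,
      (tail_mx N d r)^T *m tail_mx N d r = 1%:M,
      (tail_mx N d r)^T *m (pid_mx d : 'M[T]_(N, d)) = 0 &
      (pid_mx d : 'M[T]_(N, d)) *m (pid_mx d)^T
        + tail_mx N d r *m (tail_mx N d r)^T = 1%:M].
Proof.
move=> ->; rewrite pid_mx_col tail_mx_col; split.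
- by rewrite tr_col_mx mul_row_col trmx1 trmx0 mul1mx mul0mx addr0.
- by rewrite tr_col_mx mul_row_col trmx1 trmx0 mul1mx mul0mx add0r.
- by rewrite tr_col_mx mul_row_col trmx0 mul0mx mulmx0 addr0.
rewrite !tr_col_mx !mul_col_row !trmx1 !trmx0 !(mul1mx, mul0mx, mulmx0).
by rewrite add_block_mx !(add0r, addr0) -scalar_mx_block.
Qed.

End TailColumns.

Section BlockSplitting.
Variables (T : comPzRingType) (p : nat) (le : rel 'I_p).
Hypothesis le_poset : poset_on le.
Implicit Types (d r c : 'I_p -> nat).

(** As [le] is extended by the usual order, [j] comes first in the enumeration
    of its downset. *)
Lemma dn_first j : exists2 k : 'I_#|downset le j|, dn k = j & k = 0%N :> nat.
Proof.
have [le_refl _ _ le_nat] := le_poset.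
have [k dk] := dnP (le_refl j); exists k => //; apply/eqP.
rewrite -leqn0 leqNgt; apply/negP => k_gt0.
have lt0 := ltn_trans k_gt0 (ltn_ord k).
have := le_nat _ _ (le_dn (Ordinal lt0)); rewrite leqNgt => /negP; apply.
rewrite -[X in (_ < X)%N](congr1 val dk) /dn /=.
have : sorted ltn (map val (enum (downset le j))).
  apply: (subseq_sorted ltn_trans (s2 := map val (enum 'I_p))).
    by apply: map_subseq; rewrite enumT /enum_mem filter_subseq.
  by rewrite val_enum_ord iota_ltn_sorted.
move=> /(sorted_ltn_nth ltn_trans 0%N) srt.
rewrite !(enum_val_nth j) /=.
have := srt 0%N k; rewrite !inE size_map -cardE => /(_ lt0 (ltn_ord k) k_gt0).
by rewrite !(nth_map j) // -cardE.
Qed.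

Lemma leq_ddim d j : (d j <= ddim le d j)%N.
Proof.
have [k dk _] := dn_first j.
by rewrite /ddim (bigD1 k) //= dk leq_addr.
Qed.

(** The first columns belong to block [j], since [j] is enumerated first. *)
Lemma downE_pid_mx d j :
  downE T le d j *m (pid_mx (d j) : 'M[T]_(ddim le d j, d j)) = tallE T d j.
Proof.
have [k dk k0] := dn_first j.
have -> : pid_mx (d j) = \mxcol_q (if q == k then pid_mx (d j) else 0)
    :> 'M[T]_(ddim le d j, d j).
  apply/mxcolP => q; rewrite mxcolK; apply/matrixP => x b; rewrite !mxE.
  rewrite /tagnat.Rank tagnat.rankEsum /=.
  have [eqk|nqk] := eqVneq q k.
    by rewrite mxE big_pred0 ?add0n // => i; rewrite eqk k0 ltn0.
  rewrite (bigD1 k) /=; last by rewrite k0 lt0n -k0; apply: contra nqk.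
  rewrite dk mxE -addnA gtn_eqF //.
  by rewrite ltn_addr.
rewrite /downE mul_mxrow_mxcol (bigD1 k) //= eqxx [X in _ + X]big1 ?addr0; last first.
  by move=> q /negbTE ->; rewrite mulmx0.
by rewrite dk pid_mx_square mulmx1.
Qed.

Lemma tr_bdiag r c (M : forall j, 'M[T]_(r j, c j)) j :
  (bdiag M)^T *m tallE T r j = tallE T c j *m (M j)^T.
Proof. by rewrite -[LHS]trmxK trmx_mul trmxK mul_tallE_tr_bdiag trmx_mul trmxK. Qed.

Lemma Pi2_tallE d j :
  Pi2 le T d *m tallE T _ j
    = tallE T (ddim le d) j *m tail_mx T _ (d j) (ddim le d j - d j).
Proof. by rewrite /Pi2 mul_bdiag_tallE. Qed.

Lemma Pi_split d :
  [/\ (Pi2 le T d)^T *m Pi2 le T d = 1%:M,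
      (Pi2 le T d)^T *m Pi1 le T d = 0,
      Pi1 le T d *m (Pi1 le T d)^T + Pi2 le T d *m (Pi2 le T d)^T = 1%:M
    & Rmx le T d *m Pi1 le T d = 1%:M].
Proof.
have split_j j := pid_tail_mx T (esym (subnKC (leq_ddim d j))).
split; apply: eq_by_tallE => j; have [P11 P22 P21 PP] := split_j j;
  rewrite ?mulmxDl ?mul1mx ?mul0mx -?mulmxA.
- by rewrite Pi2_tallE mulmxA tr_bdiag -mulmxA P22 mulmx1.
- by rewrite mul_bdiag_tallE mulmxA tr_bdiag -mulmxA P21 mulmx0.
- rewrite !tr_bdiag !mulmxA mul_bdiag_tallE Pi2_tallE -!mulmxA -mulmxDr PP.
  by rewrite mulmx1.
- by rewrite mul_bdiag_tallE mulmxA Rmx_tallE downE_pid_mx.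
Qed.

End BlockSplitting.

(** * Hurwitz matrices and the algebraic Riccati equation *)

Section ComplexMatrices.
Context {R : realType}.
Local Notation C := R[i].
Local Notation cmx := (map_mx (real_complex R)).

Definition hadj m n (M : 'M[C]_(m, n)) : 'M[C]_(n, m) := (map_mx Num.conj M)^T.

Lemma hadjM m n k (M : 'M[C]_(m, n)) (N : 'M[C]_(n, k)) :
  hadj (M *m N) = hadj N *m hadj M.
Proof. by rewrite /hadj map_mxM trmx_mul. Qed.

Lemma hadjD m n (M N : 'M[C]_(m, n)) : hadj (M + N) = hadj M + hadj N.
Proof. by rewrite /hadj map_mxD linearD. Qed.

Lemma hadjZ m n (a : C) (M : 'M[C]_(m, n)) : hadj (a *: M) = a^* *: hadj M.
Proof. by rewrite /hadj map_mxZ linearZ. Qed.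

Lemma hadj_cmx m n (M : 'M[R]_(m, n)) : hadj (cmx M) = cmx M^T.
Proof.
by apply/matrixP => i j; rewrite !mxE; exact: conjc_real.
Qed.

Lemma posdef_unitmx n (M : 'M[R]_n) : posdef M -> M \in unitmx.
Proof.
move=> [_ Mpos]; rewrite unitmxE unitfE; apply/negP => /det0P[v v0 vM].
have := Mpos v^T; rewrite trmx_eq0 trmxK vM mul0mx mxE ltxx.
by move/(_ v0).
Qed.

(** For real symmetric [M] and [v = a + i b], the cross terms of [v^H M v]
    cancel, which leaves [a^T M a + b^T M b]. *)
Lemma posdef_complex n (M : 'M[R]_n) (v : 'cV[C]_n) :
  posdef M -> v != 0 -> 0 < (hadj v *m cmx M *m v) ord0 ord0.
Proof.
move=> [Msym Mpos] v0.
pose a := map_mx (@complex.Re R) v; pose b := map_mx (@complex.Im R) v.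
have vE : v = cmx a + 'i%C *: cmx b.
  by apply/matrixP => i j; rewrite !mxE -complexE.
have Mge0 (x : 'cV_n) : 0 <= (x^T *m M *m x) ord0 ord0.
  have [->|x0] := eqVneq x 0; first by rewrite mulmx0 mxE.
  exact/ltW/Mpos.
have cross : b^T *m M *m a = a^T *m M *m b.
  have tr11 (x : 'M[R]_1) : x^T = x by apply/matrixP => i j; rewrite !ord1 mxE.
  by rewrite -[LHS]tr11 !trmx_mul trmxK Msym mulmxA.
have -> : (hadj v *m cmx M *m v) ord0 ord0
    = ((a^T *m M *m a) ord0 ord0 + (b^T *m M *m b) ord0 ord0)%:C%C.
  rewrite {1 2}vE hadjD hadjZ !hadj_cmx !(mulmxDl, mulmxDr).
  rewrite -!(scalemxAl, scalemxAr) -!map_mxM cross scalerA.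
  have -> : ('i%C : C)^* = - 'i%C by apply/eqP; rewrite eq_complex /= oppr0 !eqxx.
  move: (a^T *m M *m a) (b^T *m M *m b) (a^T *m M *m b) => x y w.
  have DE (M1 M2 : 'M[C]_1) : (M1 + M2) ord0 ord0 = M1 ord0 ord0 + M2 ord0 ord0.
    by rewrite mxE.
  have ZE (k : C) (M1 : 'M[C]_1) : (k *: M1) ord0 ord0 = k * M1 ord0 ord0.
    by rewrite mxE.
  have ME (M1 : 'M[R]_1) : (cmx M1) ord0 ord0 = (M1 ord0 ord0)%:C%C by rewrite mxE.
  rewrite [LHS]DE [X in X + _]DE [X in _ + X]DE !ZE !ME.
  move: (x ord0 ord0) (y ord0 ord0) (w ord0 ord0) => {}x {}y {}w.
  by apply/eqP; rewrite eq_complex /=; apply/andP; split; apply/eqP; ring.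
rewrite -[0](rmorph0 (real_complex R)) ltcR.
have [a0|a0] := eqVneq a 0; last by rewrite ltr_pwDl // Mpos.
rewrite ltr_wpDl ?Mge0 // Mpos //; apply: contraNneq v0 => b0.
by rewrite vE a0 b0 !map_mx0 scaler0 addr0.
Qed.

Lemma hadj_self n (u : 'cV[C]_n) :
  (hadj u *m u) ord0 ord0 = \sum_i `|u i ord0| ^+ 2.
Proof. by rewrite mxE; apply: eq_bigr => i _; rewrite !mxE mulrC normCK. Qed.

Lemma hadj_self_ge0 n (u : 'cV[C]_n) : 0 <= (hadj u *m u) ord0 ord0.
Proof. by rewrite hadj_self sumr_ge0 // => i _; rewrite exprn_ge0. Qed.

Lemma hadj_self_eq0 n (u : 'cV[C]_n) : (hadj u *m u) ord0 ord0 = 0 -> u = 0.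
Proof.
rewrite hadj_self => u0; apply/matrixP => i j; rewrite ord1 mxE.
have u2ge0 k : true -> 0 <= `|u k ord0| ^+ 2 by rewrite exprn_ge0.
move/eqP: u0; rewrite psumr_eq0 // => /allP/(_ i); rewrite mem_index_enum.
by move=> /(_ isT); rewrite /= sqrf_eq0 normr_eq0 => /eqP.
Qed.

Lemma eigenvalue_right n (A : 'M[C]_n) z :
  eigenvalue A z -> exists2 v : 'cV_n, v != 0 & A *m v = z *: v.
Proof.
move=> /eigenvalueP[v vA v0].
have /det0P[w w0 wA] : \det (A - z%:M)^T == 0.
  rewrite det_tr; apply/det0P; exists v => //.
  by rewrite mulmxBr vA mul_mx_scalar subrr.
exists w^T; first by rewrite trmx_eq0.
apply/trmx_inj; rewrite trmx_mul linearZ /= trmxK.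
move: wA; rewrite linearB /= mulmxBr tr_scalar_mx mul_mx_scalar => /eqP.
by rewrite subr_eq0 => /eqP.
Qed.

Lemma eigenvalueNunit n (A : 'M[C]_n) z :
  z%:M - A \notin unitmx -> eigenvalue A z.
Proof.
rewrite unitmxE unitfE negbK => /det0P[v v0 vA]; apply/eigenvalueP; exists v => //.
by move: vA; rewrite mulmxBr mul_mx_scalar => /eqP; rewrite subr_eq0 => /eqP.
Qed.

Lemma hurwitz_unitmx n (A : 'M[R]_n) z :
  hurwitz A -> 0 <= complex.Re z -> z%:M - cmx A \in unitmx.
Proof.
move=> Ahur z0; apply: contraLR z0 => /eigenvalueNunit /Ahur.
by rewrite ltNge.
Qed.

Section AlgebraicRiccati.
Variables (n m l : nat) (A : 'M[R]_n) (B : 'M[R]_(n, m)) (Cz : 'M[R]_(l, n))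
  (D : 'M[R]_(l, m)).

(** The continuous-time algebraic Riccati expression, for one system; every
    downset is an instance. *)
Definition care (X : 'M[R]_n) : 'M[R]_n :=
  A^T *m X + X *m A - X *m B *m invmx (D^T *m D) *m B^T *m X + Cz^T *m Cz.

Definition care_gain (X : 'M[R]_n) : 'M[R]_(m, n) :=
  invmx (D^T *m D) *m B^T *m X.

Hypothesis DDpos : posdef (D^T *m D).

(** The Popov-Belevitch-Hautus form of stabilizability, in which it can be
    passed from the diagonal blocks to the downsets. *)
Definition pbh : Prop :=
  forall z (w : 'rV[C]_n), 0 <= complex.Re z ->
    w *m cmx A = z *: w -> w *m cmx B = 0 -> w = 0.

Lemma DD_care_gain X : D^T *m D *m care_gain X = B^T *m X.
Proof. by rewrite /care_gain !mulmxA mulmxV ?mul1mx // posdef_unitmx. Qed.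

Lemma tr_DD : (D^T *m D)^T = D^T *m D.
Proof. by rewrite trmx_mul trmxK. Qed.

Lemma care_quad X : X^T = X ->
  X *m B *m invmx (D^T *m D) *m B^T *m X
    = (care_gain X)^T *m (D^T *m D) *m care_gain X.
Proof.
move=> Xsym; rewrite -[RHS]mulmxA DD_care_gain /care_gain !trmx_mul trmxK.
by rewrite trmx_inv tr_DD Xsym !mulmxA.
Qed.

Lemma tr_care_gain_DD X : X^T = X ->
  (care_gain X)^T *m (D^T *m D) = X *m B.
Proof.
by move=> Xsym; apply: trmx_inj; rewrite !trmx_mul !trmxK DD_care_gain Xsym.
Qed.

Lemma care_CC X : X^T = X -> care X = 0 ->
  Cz^T *m Cz = (care_gain X)^T *m (D^T *m D) *m care_gain X
    - A^T *m X - X *m A.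
Proof.
move=> Xsym; rewrite /care care_quad // => /eqP.
rewrite addrC addr_eq0 => /eqP ->.
by rewrite opprB [A^T *m X + _]addrC opprD addrA addrAC.
Qed.

(** With [W = D^T D] and [K] the gain of [X], every complex [v] with
    [(A - B K) v = z v] satisfies
    [2 Re z * v^H X v = - (K v)^H W (K v) - |C v|^2].  If [Re z >= 0] both
    sides vanish; then [A v = z v] and the equation for [X] turns [X v] into a
    left eigenvector of [A], for [- z], that is annihilated by [B]. *)
Lemma care_hurwitz X :
  posdef X -> care X = 0 -> pbh -> hurwitz (A - B *m care_gain X).
Proof.
move=> Xpos Xric ABpbh z zeig; rewrite ltNge; apply/negP => z_ge0.
have [Xsym _] := Xpos.
have [v v0 Av] := eigenvalue_right zeig.
set K := care_gain X in zeig Av.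
pose W := D^T *m D.
have cE : cmx Cz^T *m cmx Cz = cmx K^T *m cmx W *m cmx K
    - cmx A^T *m cmx X - cmx X *m cmx A.
  by rewrite -!map_mxM -!map_mxB; congr (cmx _); apply: care_CC.
have AvE : cmx A *m v = z *: v + cmx B *m (cmx K *m v).
  by rewrite -Av map_mxB map_mxM mulmxBl !mulmxA subrK.
have WK : cmx W *m cmx K = cmx B^T *m cmx X.
  by rewrite -!map_mxM DD_care_gain.
have KW : cmx K^T *m cmx W = cmx X *m cmx B.
  by rewrite -!map_mxM tr_care_gain_DD.
have lyap : hadj (cmx Cz *m v) *m (cmx Cz *m v)
    + hadj (cmx K *m v) *m cmx W *m (cmx K *m v)
    = - ((z + z^*) *: (hadj v *m cmx X *m v)).
  set y := cmx K *m v in AvE *.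
  have yE : hadj y = hadj v *m cmx K^T by rewrite hadjM hadj_cmx.
  have AvH : hadj (cmx A *m v) = z^* *: hadj v + hadj y *m cmx B^T.
    by rewrite AvE hadjD hadjZ hadjM hadj_cmx.
  have BXv : cmx B^T *m (cmx X *m v) = cmx W *m y by rewrite !mulmxA -WK.
  have vXB : hadj v *m (cmx X *m cmx B) = hadj y *m cmx W.
    by rewrite -KW yE mulmxA.
  rewrite hadjM hadj_cmx -mulmxA (mulmxA (cmx Cz^T)) cE !mulmxBl !mulmxBr.
  rewrite -(mulmxA _ (cmx K)) -/y (mulmxA _ _ y) (mulmxA (hadj v)) -yE.
  rewrite -(hadj_cmx A) -(mulmxA (hadj (cmx A))) (mulmxA _ (hadj (cmx A))).
  rewrite -hadjM AvH mulmxDl.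
  rewrite -(mulmxA (hadj y) (cmx B^T)) BXv.
  rewrite -(mulmxA (cmx X)) AvE (mulmxDr (cmx X)) (mulmxDr (hadj v)).
  rewrite (mulmxA (cmx X) (cmx B)) (mulmxA (hadj v) (cmx X *m _)) vXB.
  rewrite -!scalemxAr -!scalemxAl -!mulmxA.
  move: (hadj v *m (cmx X *m v)) (hadj y *m (cmx W *m y)) => g h.
  by apply/matrixP => i j; rewrite !mxE; ring.
have Xv_gt0 := posdef_complex Xpos v0.
have zz : z + z^* = (complex.Re z *+ 2)%:C%C.
  by rewrite addcJ mulr_natl rmorphMn.
have zXv_le0 : - ((z + z^*) * (hadj v *m cmx X *m v) ord0 ord0) <= 0.
  by rewrite oppr_le0 mulr_ge0 ?(ltW Xv_gt0) // zz ler0c mulrn_wge0.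
have mxD11 (M1 M2 : 'M[C]_1) : (M1 + M2) ord0 ord0 = M1 ord0 ord0 + M2 ord0 ord0.
  by rewrite mxE.
have mxN11 a (M1 : 'M[C]_1) : (- (a *: M1)) ord0 ord0 = - (a * M1 ord0 ord0).
  by rewrite !mxE.
have {lyap}lyap := congr1 (fun M : 'M[C]_1 => M ord0 ord0) lyap.
rewrite mxD11 mxN11 in lyap.
have [y0|y0] := eqVneq (cmx K *m v) 0; last first.
  have := posdef_complex DDpos y0; rewrite -/W => y_gt0.
  have := ltr_wpDl (hadj_self_ge0 (cmx Cz *m v)) y_gt0.
  by rewrite lyap => /lt_le_trans/(_ zXv_le0); rewrite ltxx.
have y00 : (hadj (cmx K *m v) *m cmx W *m (cmx K *m v)) ord0 ord0 = 0.
  by rewrite y0 mulmx0 mxE.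
rewrite y00 addr0 in lyap.
have Cv0 : cmx Cz *m v = 0.
  by apply: hadj_self_eq0; apply/eqP; rewrite eq_le hadj_self_ge0 lyap zXv_le0.
have Rez0 : complex.Re z = 0.
  move/eqP: lyap; rewrite Cv0 mulmx0 mxE eq_sym oppr_eq0 mulf_eq0.
  rewrite (gt_eqF Xv_gt0) orbF zz -(rmorph0 (real_complex R)).
  by move/eqP/complexI/eqP; rewrite mulrn_eq0 /= => /eqP.
have AvE0 : cmx A *m v = z *: v by rewrite AvE y0 mulmx0 addr0.
have AXv : cmx A^T *m (cmx X *m v) = (- z) *: (cmx X *m v).
  have := congr1 (mulmx^~ v) cE => /=.
  rewrite !mulmxBl -!mulmxA Cv0 y0 AvE0 !mulmx0 sub0r -scalemxAr => /eqP.
  by rewrite eq_sym subr_eq0 scaleNr => /eqP <-; rewrite opprK.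
have Xv0 : (cmx X *m v)^T = 0.
  apply: (ABpbh (- z)).
  - by case: (z) Rez0 => a b /= ->; rewrite oppr0.
  - by rewrite -[cmx A]trmxK -trmx_mul map_trmx AXv linearZ.
  - by rewrite -[cmx B]trmxK -trmx_mul map_trmx mulmxA -WK -mulmxA y0 mulmx0 trmx0.
move: Xv_gt0; rewrite -mulmxA -[cmx X *m v]trmxK Xv0 trmx0 mulmx0 mxE.
by rewrite ltxx.
Qed.

(** Completion of squares.  On the imaginary axis the terms of [S^H X (z S)]
    and of its adjoint cancel. *)
Lemma lqr_identity k z (S F : 'M[C]_(n, k)) (U : 'M[C]_(m, k)) X :
  X^T = X -> care X = 0 -> Cz^T *m D = 0 -> z + z^* = 0 ->
  z *: S = cmx A *m S + F + cmx B *m U ->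
  let G := cmx Cz *m S + cmx D *m U in
  let N := U + cmx (care_gain X) *m S in
  hadj G *m G = hadj N *m cmx (D^T *m D) *m N
    + hadj S *m cmx X *m F + hadj F *m cmx X *m S.
Proof.
move=> Xsym Xric CD zz zS G N.
pose K := care_gain X.
have DC : D^T *m Cz = 0 by rewrite -[LHS]trmxK trmx_mul trmxK CD trmx0.
have zq : z *: (hadj S *m cmx X *m S)
    = hadj S *m cmx X *m (cmx A *m S + F + cmx B *m U).
  by rewrite -zS -scalemxAr.
have zqH : z^* *: (hadj S *m cmx X *m S)
    = hadj (cmx A *m S + F + cmx B *m U) *m cmx X *m S.
  by rewrite -zS hadjZ -!scalemxAl.
have {zq zqH}key : hadj (cmx A *m S + F + cmx B *m U) *m cmx X *m S
    = - (hadj S *m cmx X *m (cmx A *m S + F + cmx B *m U)).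
  apply/eqP; rewrite -zqH -zq -addr_eq0 -scalerDl [_ + z]addrC zz.
  by rewrite scale0r.
have GG : hadj G *m G = hadj S *m cmx (Cz^T *m Cz) *m S
    + hadj U *m cmx (D^T *m D) *m U.
  rewrite /G hadjD !hadjM !hadj_cmx !(mulmxDl, mulmxDr) !mulmxA.
  rewrite -!(mulmxA _ (cmx _^T)) -!map_mxM CD DC !map_mx0 !(mulmx0, mul0mx).
  by rewrite addr0 add0r.
have WK : hadj U *m cmx (D^T *m D) *m cmx K = hadj U *m cmx B^T *m cmx X.
  by rewrite -mulmxA -map_mxM DD_care_gain map_mxM mulmxA.
have KW : hadj S *m cmx K^T *m cmx (D^T *m D) = hadj S *m cmx X *m cmx B.
  by rewrite -mulmxA -map_mxM tr_care_gain_DD // map_mxM mulmxA.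
move: key; rewrite GG (care_CC Xsym Xric) -/K /N hadjD hadjM hadj_cmx -/K.
rewrite !hadjD !hadjM !hadj_cmx !map_mxB (map_mxM _ (_ *m _) K).
rewrite (map_mxM _ K^T) (map_mxM _ X) (map_mxM _ A^T).
rewrite !(mulmxDl, mulmxDr, mulmxN, mulNmx) !mulmxA WK KW.
set a1 := _ *m S; set a2 := _ *m S; set a3 := _ *m S.
set a4 := _ *m S; set a5 := _ *m F; set a6 := _ *m U; set a7 := _ *m S.
set a8 := _ *m U.
move: a1 a2 a3 a4 a5 a6 a7 a8 => a1 a2 a3 a4 a5 a6 a7 a8 key.
have -> : a1 = - (a4 + a5 + a6) - a2 - a3.
  by rewrite -key addrAC addrK addrK.
by apply/matrixP => i j; rewrite !mxE; ring.
Qed.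

Lemma mxtrace_hadj k (M : 'M[C]_k) : \tr (hadj M) = (\tr M)^*.
Proof. by rewrite /hadj mxtrace_tr rmorph_sum; apply: eq_bigr => i _; rewrite mxE. Qed.

Lemma mxtrace_posdef_ge0 k (M : 'M[R]_n) (N : 'M[C]_(n, k)) :
  posdef M -> 0 <= \tr (hadj N *m cmx M *m N).
Proof.
move=> Mpos; apply: sumr_ge0 => i _.
have -> : (hadj N *m cmx M *m N) i i
    = (hadj (col i N) *m cmx M *m col i N) ord0 ord0.
  have -> : hadj (col i N) = row i (hadj N) by apply/matrixP => a b; rewrite !mxE.
  rewrite -row_mul mxE [RHS]mxE; apply: eq_bigr => j _.
  by rewrite [in RHS]mxE [col _ _ _ _]mxE.
have [->|Ni0] := eqVneq (col i N) 0; first by rewrite mulmx0 mxE.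
by apply: ltW; apply: posdef_complex.
Qed.

(** Subtracting the two equations; the quadratic terms fit together because the
    gain is linear in the solution. *)
Lemma care_sub X Y : X^T = X -> Y^T = Y -> care X = 0 -> care Y = 0 ->
  (A - B *m care_gain Y)^T *m (X - Y) + (X - Y) *m (A - B *m care_gain X) = 0.
Proof.
move=> Xsym Ysym Xric Yric; rewrite -[RHS](subrr 0) -{1}Xric -Yric /care.
have KYT : (B *m care_gain Y)^T = Y *m B *m invmx (D^T *m D) *m B^T.
  by rewrite /care_gain !trmx_mul trmx_inv tr_DD trmxK Ysym !mulmxA.
rewrite [(A - _)^T]linearB /= KYT /care_gain.
rewrite !(mulmxBl, mulmxBr) !mulmxA.
move: (A^T *m X) (A^T *m Y) (X *m A) (Y *m A) (Cz^T *m Cz) => a b c d e.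
set f := _ *m X; set g := _ *m Y; set h := _ *m X.
move: f g h => f g h; apply/matrixP => i j; rewrite !mxE; ring.
Qed.

End AlgebraicRiccati.

(** Polynomials in [Q] and in [- P^T] intertwine through [M]; the one that
    annihilates [Q] is invertible at [- P^T], whose spectrum lies in the other
    half-plane. *)
Lemma sylvester_hurwitz n (P Q M : 'M[R]_n) :
  hurwitz P -> hurwitz Q -> P^T *m M + M *m Q = 0 -> M = 0.
Proof.
case: n P Q M => [|n] P Q M Phur Qhur PM; first by rewrite [M]flatmx0.
have QM : cmx M *m cmx Q = - cmx P^T *m cmx M.
  by apply/eqP; rewrite mulNmx -addr_eq0 addrC -!map_mxM -map_mxD PM map_mx0.
rewrite -[_ *m cmx Q]/(_ * _) -[- _ *m _]/(_ * _) in QM.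
have interp q : cmx M * horner_mx (cmx Q) q = horner_mx (- cmx P^T) q * cmx M.
  elim/poly_ind: q => [|q c IHq]; first by rewrite !rmorph0 mulr0 mul0r.
  rewrite !rmorphD !rmorphM /= !horner_mx_X !horner_mx_C mulrDr mulrDl mulrA.
  rewrite IHq -(mulrA _ (cmx M)) QM mulrA; congr (_ + _).
  exact: scalar_mxC.
have := interp (char_poly (cmx Q)); rewrite Cayley_Hamilton mulr0.
have [r rE] := closed_field_poly_normal (char_poly (cmx Q)).
have {rE}rE : char_poly (cmx Q) = \prod_(z <- r) ('X - z%:P).
  by rewrite rE (monicP (char_poly_monic _)) scale1r.
have rneg z : z \in r -> complex.Re z < 0.
  by move=> zr; apply: Qhur; rewrite eigenvalue_root_char rE root_prod_XsubC.
rewrite rE rmorph_prod /= => /esym qM0.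
have qu : \prod_(z <- r) horner_mx (- cmx P^T) ('X - z%:P) \is a GRing.unit.
  rewrite big_seq.
  apply: (big_ind (fun N => N \is a GRing.unit)) => [|x y|z /rneg z_lt0].
  - exact: unitr1.
  - exact: rpredM.
  rewrite rmorphB /= horner_mx_X horner_mx_C.
  rewrite addrC -raddfN; have := @hurwitz_unitmx _ P (- z) Phur.
  case: (z) z_lt0 => a b /= a_lt0; rewrite oppr_ge0 => /(_ (ltW a_lt0)).
  by rewrite -unitmx_tr linearB /= tr_scalar_mx map_trmx.
have := mulrI qu; move=> /(_ (cmx M) 0); rewrite mulr0 qM0 => /(_ erefl).
by move/matrixP => M0; apply/matrixP => i j; have := M0 i j; rewrite !mxE => /complexI.
Qed.

End ComplexMatrices.

(** * Values of rational functions; stable strictly proper functions *)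

(** Lets the theory of ring morphisms apply to [cstmx]. *)
HB.instance Definition _ (R : realType) :=
  GRing.RMorphism.copy (@ratcst R) (@FracField.tofrac {poly R} \o polyC).

Section RationalFunctions.
Context {R : realType}.
Local Notation ratfun := {fraction {poly R}}.
Local Notation C := R[i].
Local Notation cmx := (map_mx (real_complex R)).
Local Notation tofrac := (@FracField.tofrac {poly R}).
Local Notation cev q z := ((map_poly (real_complex R) q).[z]).

Lemma eq_div_cross (L : fieldType) (x y z w : L) :
  y != 0 -> w != 0 -> x / y = z / w -> x * w = z * y.
Proof. by move=> y0 w0 /eqP; rewrite eqr_div // => /eqP. Qed.

Lemma frac_reprE (f : ratfun) :
  f = tofrac (fraction.frac (generic_quotient.repr f)).1
      / tofrac (fraction.frac (generic_quotient.repr f)).2.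
Proof.
apply: (canRL (mulfK _)); first by rewrite tofrac_eq0 denom_ratioP.
rewrite -{1}[f]generic_quotient.reprK; set x := generic_quotient.repr f.
unlock FracField.tofrac; rewrite -[LHS]FracField.pi_mul.
apply/generic_quotient.eqmodP => /=.
rewrite FracField.equivfE /FracField.mulf /= !numden_Ratio ?mulf_neq0 //.
- by rewrite !mulr1 mulrC.
all: by rewrite ?denom_ratioP ?oner_neq0.
Qed.

(** Evaluation as a relation, through any fraction whose denominator does not
    vanish at [z].  Unlike [rateval] it is visibly compatible with sums and
    products. *)
Definition ratval (z : C) (f : ratfun) (v : C) : Prop :=
  exists a b : {poly R}, [/\ cev b z != 0, f = tofrac a / tofrac b
    & v = cev a z / cev b z].

Lemma cev_neq0 (b : {poly R}) z : cev b z != 0 -> b != 0.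
Proof. by apply: contraNneq => ->; rewrite map_poly0 horner0. Qed.

(** The reduced denominator divides every other denominator, so it does not
    vanish at [z] if one of them does not. *)
Lemma ratvalE z f v : ratval z f v -> rateval f z = v.
Proof.
move=> [a [b [bz fE ->]]]; rewrite /rateval.
set x := fraction.frac _; have := frac_reprE f; rewrite -/x => fx.
have d0 : x.2 != 0 by rewrite /x denom_ratioP.
have b0 := cev_neq0 bz.
move: x d0 fx => [n d] /= d0 fx.
set g := gcdp n d; set n' := n %/ g; set d' := d %/ g.
have g0 : g != 0 by rewrite gcdp_eq0 negb_and d0 orbT.
have nE : n = n' * g by rewrite divpK // dvdp_gcdl.
have dE : d = d' * g by rewrite divpK // dvdp_gcdr.
have cross : n' * b = a * d'.
  apply: (mulIf g0); rewrite mulrAC -nE -mulrA -dE; apply/eqP.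
  rewrite -tofrac_eq !tofracM; apply/eqP; apply: eq_div_cross.
  - by rewrite tofrac_eq0.
  - by rewrite tofrac_eq0.
  - by rewrite -fx fE.
have cop : coprimep d' n'.
  by rewrite coprimep_sym; apply: coprimep_div_gcd; rewrite d0 orbT.
have : d' %| b by rewrite -(Gauss_dvdpr _ cop) cross dvdp_mull.
case/dvdpP => c bE.
have d'z : cev d' z != 0.
  by apply: contraNneq bz => dz; rewrite bE rmorphM hornerM dz mulr0.
apply/eqP; rewrite eqr_div // -!hornerM -!rmorphM cross.
by [].
Qed.

Lemma ratvalD z f g v w :
  ratval z f v -> ratval z g w -> ratval z (f + g) (v + w).
Proof.
move=> [a [b [bz -> ->]]] [c [d [dz -> ->]]]; exists (a * d + c * b), (b * d).
split; first by rewrite rmorphM hornerM mulf_neq0.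
  by rewrite addf_div ?tofrac_eq0 ?(cev_neq0 bz) ?(cev_neq0 dz) // rmorphD !rmorphM.
by rewrite addf_div // rmorphD !rmorphM hornerD !hornerM.
Qed.

Lemma ratvalM z f g v w :
  ratval z f v -> ratval z g w -> ratval z (f * g) (v * w).
Proof.
move=> [a [b [bz -> ->]]] [c [d [dz -> ->]]]; exists (a * c), (b * d).
split; first by rewrite rmorphM hornerM mulf_neq0.
  by rewrite mulf_div !rmorphM.
by rewrite mulf_div !rmorphM !hornerM.
Qed.

Lemma ratval_poly z q : ratval z (tofrac q) (cev q z).
Proof.
exists q, 1; rewrite !rmorph1 hornerE oner_eq0 !divr1; split=> //.
Qed.

Lemma ratval_cst z c : ratval z (ratcst c) (real_complex R c).
Proof. by have := ratval_poly z c%:P; rewrite map_polyC hornerC. Qed.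

Lemma ratval_var z : ratval z ratvar z.
Proof. by have := ratval_poly z 'X; rewrite map_polyX hornerX. Qed.

Lemma ratvalB z (f g : ratfun) v w :
  ratval z f v -> ratval z g w -> ratval z (f - g) (v - w).
Proof.
move=> fv gw; rewrite -[- g]mulN1r -[- w]mulN1r; apply: ratvalD => //.
by apply: ratvalM => //; have := ratval_cst z (-1 : R); rewrite !rmorphN1.
Qed.
Definition mxratval z m n (G : 'M[ratfun]_(m, n)) (V : 'M[C]_(m, n)) : Prop :=
  forall i j, ratval z (G i j) (V i j).

Lemma tfevalE z m n (G : 'M[ratfun]_(m, n)) V : mxratval z G V -> tfeval G z = V.
Proof. by move=> GV; apply/matrixP => i j; rewrite mxE (ratvalE (GV i j)). Qed.

Lemma mxratvalD z m n (G H : 'M[ratfun]_(m, n)) V W :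
  mxratval z G V -> mxratval z H W -> mxratval z (G + H) (V + W).
Proof. by move=> GV HW i j; rewrite !mxE; apply: ratvalD. Qed.

Lemma mxratvalM z m n k (G : 'M[ratfun]_(m, n)) (H : 'M[ratfun]_(n, k)) V W :
  mxratval z G V -> mxratval z H W -> mxratval z (G *m H) (V *m W).
Proof.
move=> GV HW i j; rewrite !mxE; apply: (big_ind2 (ratval z)) => //.
- by have := ratval_cst z 0; rewrite !rmorph0.
- by move=> *; apply: ratvalD.
- by move=> q _; apply: ratvalM.
Qed.

Lemma mxratval_cst z m n (M : 'M[R]_(m, n)) : mxratval z (cstmx M) (cmx M).
Proof. by move=> i j; rewrite !mxE; apply: ratval_cst. Qed.

Lemma mxratval_var z m n (G : 'M[ratfun]_(m, n)) V :
  mxratval z G V -> mxratval z (ratvar *: G) (z *: V).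
Proof. by move=> GV i j; rewrite !mxE; exact: ratvalM (ratval_var z) (GV i j). Qed.

Definition stable_poly (b : {poly R}) : Prop :=
  forall z, 0 <= complex.Re z -> cev b z != 0.

(** Stable, strictly proper rational functions; they are closed under real linear
    combinations, and [rateval] respects the ring operations on them in the closed
    right half-plane. *)
Definition sps (f : ratfun) : Prop :=
  exists a b : {poly R},
    [/\ stable_poly b, (size a < size b)%N & f = tofrac a / tofrac b].

Lemma stable_poly_neq0 b : stable_poly b -> b != 0.
Proof. by move=> /(_ 0 (lexx _)); apply: cev_neq0. Qed.

Lemma stable_polyM a b : stable_poly a -> stable_poly b -> stable_poly (a * b).
Proof.
by move=> sa sb z z0; rewrite rmorphM hornerM mulf_neq0 ?sa ?sb.
Qed.

Lemma sps_ratval f z : sps f -> 0 <= complex.Re z -> ratval z f (rateval f z).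
Proof.
move=> [a [b [bst _ fE]]] z0.
have fz : ratval z f (cev a z / cev b z) by exists a, b; rewrite bst.
by rewrite (ratvalE fz).
Qed.

Lemma size_mulB (a b c : {poly R}) : c != 0 ->
  (size a < size b)%N -> (size (a * c)%R < size (b * c)%R)%N.
Proof.
move=> c0 ab; have b0 : b != 0 by rewrite -size_poly_gt0; apply: leq_ltn_trans ab.
rewrite (size_mul b0 c0) (leq_ltn_trans (size_polyMleq _ _)) //.
have : (0 < size c)%N by rewrite size_poly_gt0.
by case: (size c) => // k _; rewrite !addnS /= ltn_add2r.
Qed.

Lemma spsD f g : sps f -> sps g -> sps (f + g).
Proof.
move=> [a [b [bst ab ->]]] [c [d [dst cd ->]]].
have b0 := stable_poly_neq0 bst; have d0 := stable_poly_neq0 dst.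
exists (a * d + c * b), (b * d); split; first exact: stable_polyM.
  rewrite (leq_ltn_trans (size_polyD _ _)) // gtn_max size_mulB //=.
  by rewrite [b * d]mulrC size_mulB.
by rewrite addf_div ?tofrac_eq0 // rmorphD !rmorphM.
Qed.

Lemma sps_cstM c f : sps f -> sps (ratcst c * f).
Proof.
move=> [a [b [bst ab ->]]]; exists (c%:P * a), b; split=> //.
  by rewrite mul_polyC (leq_ltn_trans (size_scale_leq _ _)).
by rewrite mulrA rmorphM.
Qed.

Lemma sps0 : sps 0.
Proof.
exists 0, 1; split; last by rewrite rmorph0 mul0r.
  by move=> z _; rewrite rmorph1 hornerE oner_eq0.
by rewrite size_poly0 size_poly1.
Qed.

Definition mxsps m n (G : 'M[ratfun]_(m, n)) : Prop := forall i j, sps (G i j).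

Lemma mxspsD m n (G H : 'M[ratfun]_(m, n)) : mxsps G -> mxsps H -> mxsps (G + H).
Proof. by move=> Gs Hs i j; rewrite mxE; apply: spsD. Qed.

Lemma mxsps_cstl m n k (M : 'M[R]_(m, n)) (G : 'M[ratfun]_(n, k)) :
  mxsps G -> mxsps (cstmx M *m G).
Proof.
move=> Gs i j; rewrite mxE; apply: big_ind => [||q _]; first exact: sps0.
  exact: spsD.
by rewrite mxE; apply: sps_cstM; apply: Gs.
Qed.

Lemma mxsps_cstr m n k (G : 'M[ratfun]_(m, n)) (M : 'M[R]_(n, k)) :
  mxsps G -> mxsps (G *m cstmx M).
Proof.
move=> Gs i j; rewrite mxE; apply: big_ind => [||q _]; first exact: sps0.
  exact: spsD.
by rewrite mxE mulrC; apply: sps_cstM; apply: Gs.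
Qed.

Lemma mxspsN m n (G : 'M[ratfun]_(m, n)) : mxsps G -> mxsps (- G).
Proof.
move=> Gs; have -> : - G = cstmx (- 1%:M) *m G.
  by rewrite /cstmx map_mxN map_mx1 mulNmx mul1mx.
exact: mxsps_cstl.
Qed.

Lemma mxsps_val m n (G : 'M[ratfun]_(m, n)) z :
  mxsps G -> 0 <= complex.Re z -> mxratval z G (tfeval G z).
Proof. by move=> Gs z0 i j; rewrite mxE; apply: sps_ratval. Qed.

End RationalFunctions.

(** * Resolvents and the closed loop *)

Section ClosedLoop.
Context {R : realType}.
Local Notation ratfun := {fraction {poly R}}.
Local Notation tofrac := (@FracField.tofrac {poly R}).
Local Notation cmx := (map_mx (real_complex R)).

Definition smx n (A : 'M[R]_n) : 'M[ratfun]_n := ratvar%:M - cstmx A.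

Lemma smxE n (A : 'M[R]_n) : smx A = map_mx tofrac (char_poly_mx A).
Proof.
rewrite /smx /char_poly_mx map_mxB map_scalar_mx; congr (_ - _).
by apply/matrixP => i j; rewrite !mxE.
Qed.

Lemma smx_unitmx n (A : 'M[R]_n) : smx A \in unitmx.
Proof.
rewrite unitmxE unitfE smxE det_map_mx tofrac_eq0.
exact/monic_neq0/char_poly_monic.
Qed.

Lemma invmx_smx n (A : 'M[R]_n) :
  invmx (smx A) = (tofrac (char_poly A))^-1 *: map_mx tofrac (\adj (char_poly_mx A)).
Proof. by rewrite /invmx smx_unitmx smxE map_mx_adj det_map_mx. Qed.

Lemma size_det_leq n (M : 'M[{poly R}]_n) :
  (forall i j, (size (M i j) <= 2)%N) -> (size (\det M) <= n.+1)%N.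
Proof.
move=> M2; apply: (leq_trans (size_sum _ _ _)); apply/bigmax_leqP => s _.
rewrite -signr_odd mulr_sign; case: ifP => _; rewrite ?size_polyN.
all: apply: (leq_trans (size_poly_prod_leq _ _)).
all: rewrite leq_subLR addnS ltnS cardT size_enum_ord addnn -muln2.
all: have <- : (\sum_(i < n) 2 = n * 2)%N by rewrite sum_nat_const card_ord.
all: by apply: leq_sum.
Qed.

Lemma size_adj_char_poly n (A : 'M[R]_n) i j :
  (size (\adj (char_poly_mx A) i j) <= n)%N.
Proof.
case: n A i j => [|n] A i j; first by case: i.
rewrite mxE /cofactor -signr_odd mulr_sign.
have sz : (size (\det (row' j (col' i (char_poly_mx A)))) <= n.+1)%N.
  apply: size_det_leq => k q; rewrite !mxE.
  apply: (leq_trans (size_polyD _ _)); rewrite size_polyN geq_max.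
  rewrite (leq_trans (size_polyC_leq1 _)) // andbT.
  by case: eqP => _; rewrite ?mulr1n ?mulr0n ?size_polyX ?size_poly0.
by case: ifP => _; rewrite ?size_polyN.
Qed.

Lemma hurwitz_stable_poly n (A : 'M[R]_n) : hurwitz A -> stable_poly (char_poly A).
Proof.
move=> Ahur z z0; rewrite map_char_poly -/(root _ z) -eigenvalue_root_char.
by apply: contraL z0 => /Ahur; rewrite ltNge.
Qed.

Lemma mxsps_invmx_smx n (A : 'M[R]_n) : hurwitz A -> mxsps (invmx (smx A)).
Proof.
move=> Ahur i j; rewrite invmx_smx mxE [map_mx _ _ _ _]mxE.
exists (\adj (char_poly_mx A) i j), (char_poly A); split; last by rewrite mulrC.
  exact: hurwitz_stable_poly.
by rewrite size_char_poly ltnS size_adj_char_poly.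
Qed.

Lemma proper_ss_tf k m n (A : 'M[R]_k) (B : 'M[R]_(k, n)) (C : 'M[R]_(m, k))
    (D : 'M[R]_(m, n)) : proper_tf (ss_tf A B C D).
Proof.
move=> i j.
pose N := map_mx polyC C *m \adj (char_poly_mx A) *m map_mx polyC B.
exists (N i j + D i j *: char_poly A), (char_poly A).
have chi0 : char_poly A != 0 by apply/monic_neq0/char_poly_monic.
have szC (c : R) (q : {poly R}) s : (size q <= s)%N -> (size (c%:P * q)%R <= s)%N.
  by move=> qs; rewrite mul_polyC (leq_trans (size_scale_leq _ _)).
split=> //.
  rewrite (leq_trans (size_polyD _ _)) // geq_max size_scale_leq andbT.
  rewrite size_char_poly leqW // mxE.
  apply: (leq_trans (size_sum _ _ _)); apply/bigmax_leqP => s _.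
  rewrite [map_mx _ _ _ _]mxE mulrC szC // mxE.
  apply: (leq_trans (size_sum _ _ _)); apply/bigmax_leqP => t _.
  by rewrite [map_mx _ _ _ _]mxE szC // size_adj_char_poly.
rewrite rmorphD mulrDl -mul_polyC rmorphM /= mulfK ?tofrac_eq0 //.
rewrite /ss_tf -/(smx A) invmx_smx -scalemxAr -scalemxAl mxE.
have cstE p q (M : 'M[R]_(p, q)) : cstmx M = map_mx tofrac (map_mx polyC M).
  by apply/matrixP => a b; rewrite !mxE.
rewrite !cstE -!map_mxM -/N; congr (_ + _); last by rewrite !mxE.
by rewrite mxE [map_mx _ _ _ _]mxE mulrC.
Qed.

Lemma mulmx1_invmx (L : fieldType) n (M N : 'M[L]_n) : M *m N = 1%:M -> invmx M = N.
Proof.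
move=> MN; have [Mu _] := mulmx1_unit MN.
by rewrite -[N](mulKmx Mu) MN mulmx1.
Qed.

(** The linear fractional map of the problem, with [a] in the place of [s - A]. *)
Lemma linear_fractional (L : fieldType) nx nu nw l (a : 'M[L]_nx)
    (b : 'M[L]_(nx, nu)) (c : 'M[L]_(l, nx)) (d : 'M[L]_(l, nu))
    (f : 'M[L]_(nx, nw)) (k : 'M[L]_(nu, nx)) :
  a \in unitmx -> a - b *m k \in unitmx ->
  c *m invmx a *m f + (c *m invmx a *m b + d) *m k
      *m invmx (1%:M - invmx a *m b *m k) *m (invmx a *m f)
    = (c *m invmx (a - b *m k) + d *m (k *m invmx (a - b *m k))) *m f.
Proof.
move=> au Lu; set t := invmx (a - b *m k).
have at_ : a *m t = 1%:M + b *m k *m t.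
  by rewrite -{1}[a](subrK (b *m k)) mulmxDl mulmxV.
have -> : invmx (1%:M - invmx a *m b *m k) = t *m a.
  have -> : 1%:M - invmx a *m b *m k = invmx a *m (a - b *m k).
    by rewrite mulmxBr mulVmx // mulmxA.
  by apply: mulmx1_invmx; rewrite mulmxA mulmxK // mulVmx.
have tE : t = invmx a + invmx a *m (b *m k *m t).
  by rewrite -[LHS](mulKmx au) at_ mulmxDr mulmx1.
rewrite (mulmxA _ (invmx a)) -(mulmxA _ (t *m a)) -(mulmxA t) (mulmxV au) mulmx1.
rewrite -mulmxDl; congr (_ *m _).
rewrite {2}tE mulmxDr !mulmxDl !mulmxA -addrA; congr (_ + _).
Qed.

Section StateResponse.
Variables (nx nu : nat) (A : 'M[R]_nx) (B : 'M[R]_(nx, nu))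
  (K : 'M[ratfun]_(nu, nx)).

(** Its inverse, times [F], is the response of the plant state to [w]. *)
Definition loopmx : 'M[ratfun]_nx := smx A - cstmx B *m K.

(** Eliminating the controller state from the interconnection shows that the
    inverse of [s - A - B K] is a block of the resolvent of its state matrix, and
    that [K] times this inverse combines two blocks. *)
Lemma stabilizing_loopmx : stabilizing A B K ->
  [/\ loopmx \in unitmx, mxsps (invmx loopmx) & mxsps (K *m invmx loopmx)].
Proof.
move=> [k [Ak [Bk [Ck [Dk [KE hur]]]]]].
set Acl := block_mx _ _ _ _ in hur.
have PE : smx Acl = block_mx (smx A - cstmx (B *m Dk)) (- cstmx (B *m Ck))
                             (- cstmx Bk) (smx Ak).
  rewrite /smx /cstmx map_block_mx scalar_mx_block opp_block_mx add_block_mx.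
  by rewrite !sub0r map_mxD opprD addrA.
have Ps := mxsps_invmx_smx hur; have Pu := smx_unitmx Acl.
pose Y := ulsubmx (invmx (smx Acl)); pose Z := dlsubmx (invmx (smx Acl)).
pose xi := invmx (smx Ak) *m cstmx Bk.
have Kxi : K = cstmx Ck *m xi + cstmx Dk by rewrite KE /ss_tf /xi mulmxA.
have Pxi : smx Acl *m col_mx 1%:M xi = col_mx loopmx 0.
  rewrite PE mul_block_col !mulmx1 /xi (mulmxA (smx Ak)).
  rewrite (mulmxV (smx_unitmx Ak)) mul1mx addNr -/xi /loopmx Kxi.
  congr col_mx; rewrite mulNmx /cstmx !map_mxM mulmxDr mulmxA opprD.
  by rewrite -addrA [- _ - _]addrC.
have YZ : col_mx (Y *m loopmx) (Z *m loopmx) = col_mx 1%:M xi.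
  rewrite -[RHS](mulKmx Pu) Pxi -[invmx (smx Acl)]submxK mul_block_col.
  by rewrite !mulmx0 !addr0.
have [YL ZL] := eq_col_mx YZ.
have [Yu Lu] := mulmx1_unit YL.
have YE : invmx loopmx = Y by rewrite -[Y](mulmxK Lu) YL mul1mx.
have ZE : xi *m Y = Z by rewrite -YE -ZL mulmxK.
have Ysps : mxsps Y by move=> i j; rewrite !mxE; apply: Ps.
have Zsps : mxsps Z by move=> i j; rewrite !mxE; apply: Ps.
split=> //; rewrite YE // Kxi mulmxDl -mulmxA ZE.
by apply: mxspsD; apply: mxsps_cstl.
Qed.

Lemma s_invmx_loopmx : loopmx \in unitmx ->
  ratvar *: invmx loopmx
    = cstmx A *m invmx loopmx + 1%:M + cstmx B *m (K *m invmx loopmx).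
Proof.
move=> Lu; have := mulmxV Lu; rewrite {1}/loopmx /smx !mulmxBl => LT.
rewrite -[1%:M]LT mul_scalar_mx mulmxA.
move: (ratvar *: _) (cstmx A *m _) (cstmx B *m K *m _) => x y z.
by rewrite addrA subrK addrC subrK.
Qed.

Lemma closed_loopE l nw (Cz : 'M[R]_(l, nx)) (D : 'M[R]_(l, nu))
    (F : 'M[R]_(nx, nw)) : loopmx \in unitmx ->
  closed_loop A B Cz D F K
    = (cstmx Cz *m invmx loopmx + cstmx D *m (K *m invmx loopmx)) *m cstmx F.
Proof.
move=> Lu; have Au := smx_unitmx A.
have cst0 m n : cstmx (0 : 'M[R]_(m, n)) = 0 by rewrite /cstmx map_mx0.
have cst1 m : cstmx (1%:M : 'M[R]_m) = 1%:M by rewrite /cstmx map_mx1.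
have E : forall m n (M : 'M[R]_(nx, m)) (N : 'M[R]_(n, nx)) (Q : 'M[R]_(n, m)),
    ss_tf A M N Q = cstmx N *m invmx (smx A) *m cstmx M + cstmx Q by [].
rewrite /closed_loop /P11 /P12 /P21 /P22 !E.
rewrite !cst0.
rewrite !cst1.
rewrite !mul1mx.
rewrite !addr0.
exact: (linear_fractional (cstmx Cz) (cstmx D) (cstmx F) Au Lu).
Qed.

End StateResponse.

End ClosedLoop.

Import numFieldNormedType.Exports.
Local Open Scope classical_set_scope.

(** * Functions of mean zero on the imaginary axis *)

Section ComplexValued.
Context {R : realType}.
Local Notation C := R[i].
Local Notation Re := complex.Re.
Local Notation Im := complex.Im.
Implicit Types (f g : R -> C) (z : C).

Lemma ReM (x y : C) : Re (x * y) = Re x * Re y - Im x * Im y.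
Proof. by case: x y => a b [c d]. Qed.

Lemma ImM (x y : C) : Im (x * y) = Re x * Im y + Im x * Re y.
Proof. by case: x y => a b [c d]. Qed.

Lemma ReD (x y : C) : Re (x + y) = Re x + Re y.
Proof. by case: x y => a b [c d]. Qed.

Lemma ImD (x y : C) : Im (x + y) = Im x + Im y.
Proof. by case: x y => a b [c d]. Qed.

Lemma ReV (x : C) : Re (x^-1) = Re x / (Re x * Re x + Im x * Im x).
Proof. by case: x => a b /=; rewrite !expr2. Qed.

Lemma ImV (x : C) : Im (x^-1) = - Im x / (Re x * Re x + Im x * Im x).
Proof. by case: x => a b /=; rewrite !expr2 mulNr. Qed.

Lemma normsq_gt0 (x : C) : x != 0 -> 0 < Re x * Re x + Im x * Im x.
Proof.
rewrite -!expr2; case: x => a b /=; rewrite eq_complex /= negb_and => /orP[] h.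
  by rewrite ltr_pwDl ?sqr_ge0 // lt_neqAle sqr_ge0 eq_sym sqrf_eq0 h.
by rewrite ltr_wpDl ?sqr_ge0 // lt_neqAle sqr_ge0 eq_sym sqrf_eq0 h.
Qed.

(** Componentwise, so that only derivatives of real functions occur. *)
Definition cder f (f' : R -> C) : Prop := forall x : R,
  is_derive x (1 : R) (fun w => Re (f w)) (Re (f' x)) /\
  is_derive x (1 : R) (fun w => Im (f w)) (Im (f' x)).

Lemma cder_ext f g f' g' : f =1 g -> f' =1 g' -> cder f f' -> cder g g'.
Proof. by move=> /funext -> /funext ->. Qed.

Lemma cder_cst z : cder (fun=> z) (fun=> 0).
Proof. by move=> x; split; exact: is_derive_cst. Qed.

Lemma cderD f g f' g' : cder f f' -> cder g g' ->
  cder (fun w => f w + g w) (fun w => f' w + g' w).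
Proof.
move=> df dg x; have [df1 df2] := df x; have [dg1 dg2] := dg x; split.
  under eq_fun do rewrite ReD; rewrite ReD; exact: is_deriveD.
under eq_fun do rewrite ImD; rewrite ImD; exact: is_deriveD.
Qed.

Lemma cderM f g f' g' : cder f f' -> cder g g' ->
  cder (fun w => f w * g w) (fun w => f' w * g w + f w * g' w).
Proof.
move=> df dg x; have [df1 df2] := df x; have [dg1 dg2] := dg x; split.
  under eq_fun do rewrite ReM.
  apply: (is_derive_eq (is_deriveB (is_deriveM df1 dg1) (is_deriveM df2 dg2))).
  by rewrite ReD !ReM /GRing.scale /=; ring.
under eq_fun do rewrite ImM.
apply: (is_derive_eq (is_deriveD (is_deriveM df1 dg2) (is_deriveM df2 dg1))).
by rewrite ImD !ImM /GRing.scale /=; ring.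
Qed.

Lemma cderV f f' : (forall w, f w != 0) -> cder f f' ->
  cder (fun w => (f w)^-1) (fun w => - f' w * (f w)^-1 ^+ 2).
Proof.
move=> f0 df x; have [df1 df2] := df x.
have n0 : Re (f x) * Re (f x) + Im (f x) * Im (f x) != 0 by rewrite gt_eqF ?normsq_gt0.
have dn : is_derive x 1 (fun w => Re (f w) * Re (f w) + Im (f w) * Im (f w))
    (2 * Re (f x) * Re (f' x) + 2 * Im (f x) * Im (f' x)).
  apply: (is_derive_eq (is_deriveD (is_deriveM df1 df1) (is_deriveM df2 df2))).
  by rewrite /GRing.scale /=; ring.
have dv := @is_deriveV R
  (fun w => Re (f w) * Re (f w) + Im (f w) * Im (f w)) x _ 1 n0 dn.
split.
  under eq_fun do rewrite ReV.
  apply: (is_derive_eq (is_deriveM df1 dv)).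
  rewrite expr2 !(ReM, ImM, ReV, ImV) /GRing.scale /=.
  case: (f x) (f' x) n0 => a b [c d] /= n0.
  by field.
under eq_fun do rewrite ImV.
have dN : is_derive x 1 (fun w => - Im (f w)) (- Im (f' x)) := is_deriveN df2.
apply: (is_derive_eq (is_deriveM dN dv)).
rewrite expr2 !(ReM, ImM, ReV, ImV) /GRing.scale /=.
case: (f x) (f' x) n0 => a b [c d] /= n0.
by field.
Qed.

Definition iline z (w : R) : C := Complex 0 w - z.

Lemma cder_iline z : cder (iline z) (fun=> Complex 0 1).
Proof.
case: z => a b x; split => /=.
  exact: is_derive_cst.
apply: (is_derive_eq (is_deriveB (is_derive_id x 1) (is_derive_cst b x 1))).
by rewrite subr0.
Qed.

Lemma iline_neq0 z w : Re z < 0 -> iline z w != 0.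
Proof.
case: z => a b /= a0; rewrite eq_complex /= negb_and sub0r oppr_eq0.
by rewrite (lt_eqF a0).
Qed.

(** The value of [1 / (s - z)] at [s = i w]. *)
Definition pole z (w : R) : C := (iline z w)^-1.

Lemma cder_pole z : Re z < 0 ->
  cder (pole z) (fun w => - Complex 0 1 * pole z w ^+ 2).
Proof. by move=> z0; apply: cderV (cder_iline z) => w; apply: iline_neq0. Qed.

Lemma cderX f f' n : cder f f' ->
  cder (fun w => f w ^+ n.+1) (fun w => n.+1%:R * f w ^+ n * f' w).
Proof.
move=> df; elim: n => [|n IHn].
  by apply: cder_ext df => w; rewrite /= ?expr0 ?mul1r.
by apply: cder_ext (cderM df IHn) => w; rewrite /= ?exprS //; ring.
Qed.

Section Limits.
Variables (F : set_system R).
Context {FF : Filter F}.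

Definition czero f : Prop :=
  (Re (f w) @[w --> F] --> (0 : R)) /\ (Im (f w) @[w --> F] --> (0 : R)).

Lemma czeroD f g : czero f -> czero g -> czero (fun w => f w + g w).
Proof.
move=> [f1 f2] [g1 g2]; split.
  under eq_fun do rewrite ReD; rewrite -[0]addr0; exact: cvgD.
under eq_fun do rewrite ImD; rewrite -[0]addr0; exact: cvgD.
Qed.

Lemma czeroM f g : czero f -> czero g -> czero (fun w => f w * g w).
Proof.
move=> [f1 f2] [g1 g2]; split.
  under eq_fun do rewrite ReM.
  by rewrite -[0]subr0 -{1}[0](mulr0 0) -[X in _ - X](mulr0 0); apply: cvgB; apply: cvgM.
under eq_fun do rewrite ImM.
by rewrite -[0]addr0 -{1}[0](mulr0 0) -[X in _ + X](mulr0 0); apply: cvgD; apply: cvgM.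
Qed.

Lemma czeroZ z f : czero f -> czero (fun w => z * f w).
Proof.
move=> [f1 f2]; split.
  under eq_fun do rewrite ReM.
  rewrite -[0]subr0 -{1}[0](mulr0 (Re z)) -[X in _ - X](mulr0 (Im z)).
  by apply: cvgB; apply: cvgM => //; exact: cvg_cst.
under eq_fun do rewrite ImM.
rewrite -[0]addr0 -{1}[0](mulr0 (Re z)) -[X in _ + X](mulr0 (Im z)).
by apply: cvgD; apply: cvgM => //; exact: cvg_cst.
Qed.

(** For [w] other than [Im z], both components of [pole z w] are at most
    [1 / |w - Im z|] in modulus. *)
Lemma czero_pole z : Re z < 0 -> (forall t, \forall w \near F, t < `|w|) ->
  czero (pole z).
Proof.
move=> z0 Foo; case: z z0 => a b /= a0.
have bound e w : 0 < e -> `|b| + e^-1 < `|w| ->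
    `|Re (pole (Complex a b) w)| < e /\ `|Im (pole (Complex a b) w)| < e.
  move=> e0 wbig; rewrite /pole /iline ReV ImV /= sub0r mulrNN.
  set d := w - b; have wb : e^-1 < `|d|.
    by rewrite (lt_le_trans _ (lerB_dist _ _)) // ltrBrDl.
  have d0 : 0 < `|d| by rewrite (lt_trans _ wb) // invr_gt0.
  set n2 := a * a + d * d.
  have n2_gt0 : 0 < n2.
    by rewrite /n2 -!expr2 ltr_wpDl ?sqr_ge0 // -real_normK ?num_real ?exprn_gt0.
  have small x : `|x| * `|d| <= n2 -> `|x / n2| < e.
    move=> xd; rewrite normrM normfV (gtr0_norm n2_gt0) ltr_pdivrMr //.
    have : `|x| <= n2 / `|d| by rewrite ler_pdivlMr.
    move/le_lt_trans; apply; rewrite mulrC ltr_pM2r //.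
    by rewrite -[e]invrK ltf_pV2 // posrE invr_gt0.
  rewrite !mulNr !normrN; split; apply: small.
    have := sqr_ge0 (`|a| - `|d|); rewrite /n2 sqrrB -!expr2 !real_normK ?num_real //.
    move=> h; have := sqr_ge0 a; have := sqr_ge0 d; nra.
  by rewrite -expr2 real_normK ?num_real // /n2 -!expr2 lerDr sqr_ge0.
split; apply/cvgr0Pnorm_lt => e e0; near=> w.
  have [] // := bound e w e0; near: w; exact: Foo.
have [] // := bound e w e0; near: w; exact: Foo.
Unshelve. all: by end_near.
Qed.

End Limits.

(** The antiderivative [g] vanishes at both ends of the real line, so that the
    integral of [f] over the line is zero. *)
Definition zero_mean f : Prop :=
  exists g, [/\ cder g f, czero +oo g & czero -oo g].

Lemma zero_meanD f g : zero_mean f -> zero_mean g -> zero_mean (fun w => f w + g w).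
Proof.
move=> [f1 [df fp fn]] [g1 [dg gp gn]]; exists (fun w => f1 w + g1 w).
by split; [exact: cderD|exact: czeroD|exact: czeroD].
Qed.

Lemma zero_meanZ z f : zero_mean f -> zero_mean (fun w => z * f w).
Proof.
move=> [g [dg gp gn]]; exists (fun w => z * g w).
split; [|exact: czeroZ|exact: czeroZ].
by apply: cder_ext (cderM (cder_cst z) dg) => // w /=; rewrite mul0r add0r.
Qed.

Lemma zero_mean0 : zero_mean (fun=> 0).
Proof.
by exists (fun=> 0); split; [exact: cder_cst|split; exact: cvg_cst|split; exact: cvg_cst].
Qed.

Lemma zero_mean_ext f g : f =1 g -> zero_mean f -> zero_mean g.
Proof. by move=> /funext ->. Qed.

Lemma pinfty_normr t : \forall w \near (+oo : set_system R), t < `|w|.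
Proof.
near=> w; rewrite (@lt_le_trans _ _ w) ?ler_norm //.
by near: w; apply: nbhs_pinfty_gt; rewrite num_real.
Unshelve. all: by end_near.
Qed.

Lemma ninfty_normr t : \forall w \near (-oo : set_system R), t < `|w|.
Proof.
near=> w; rewrite (@lt_le_trans _ _ (- w)) ?ler_normr ?lexx ?orbT //.
by rewrite ltrNr; near: w; apply: nbhs_ninfty_lt; rewrite num_real.
Unshelve. all: by end_near.
Qed.

Lemma czero_poleT z : Re z < 0 -> czero +oo (pole z) /\ czero -oo (pole z).
Proof.
by move=> z0; split; apply: czero_pole => // t; [exact: pinfty_normr|exact: ninfty_normr].
Qed.

Lemma czeroX (F : set_system R) {FF : Filter F} f n :
  czero F f -> czero F (fun w => f w ^+ n.+1).
Proof.
move=> f0; elim: n => [|n IHn]; first by under eq_fun do rewrite expr1.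
by under eq_fun do rewrite exprS; apply: czeroM.
Qed.

(** A multiple of the preceding power is an antiderivative. *)
Lemma zero_mean_poleX z n : Re z < 0 -> zero_mean (fun w => pole z w ^+ n.+2).
Proof.
move=> z0; have [zp zn] := czero_poleT z0.
exists (fun w => (n.+1%:R^-1 * Complex 0 1) * pole z w ^+ n.+1).
split; [|exact/czeroZ/czeroX|exact/czeroZ/czeroX].
apply: cder_ext (cderM (cder_cst _) (cderX n (cder_pole z0))) => // w /=.
rewrite mul0r add0r.
have ii : Complex 0 1 * Complex 0 1 = -1 :> C by rewrite -expr2 sqr_i.
have n0 : n.+1%:R != 0 :> C by rewrite pnatr_eq0.
rewrite !exprS expr0; move: (pole z w) (_ ^+ n) => r q.
transitivity (- (Complex 0 1 * Complex 0 1) * (r * (r * q))); first by field.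
by rewrite ii opprK mul1r.
Qed.

Definition normsq (x : C) : R := Re x * Re x + Im x * Im x.

Lemma normsqM x y : normsq (x * y) = normsq x * normsq y.
Proof. by rewrite /normsq ReM ImM; ring. Qed.

Lemma atan_line_pinfty (a b : R) : 0 < a ->
  atan ((w - b) / a) @[w --> +oo] --> (pi / 2 : R).
Proof.
move=> a0; apply: cvg_comp (@cvgy_atan R); apply/cvgryPgt => t; near=> w.
rewrite ltr_pdivlMr // ltrBrDr; near: w.
by apply: nbhs_pinfty_gt; rewrite num_real.
Unshelve. all: by end_near.
Qed.

Lemma atan_line_ninfty (a b : R) : 0 < a ->
  atan ((w - b) / a) @[w --> -oo] --> (- (pi / 2) : R).
Proof.
move=> a0; under eq_fun do rewrite -[_ / _]opprK atanN.
apply: cvgN; apply: cvg_comp (@cvgy_atan R); apply/cvgryPgt => t; near=> w.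
rewrite ltrNr ltr_pdivrMr // ltrBlDr; near: w.
by apply: nbhs_ninfty_lt; rewrite num_real.
Unshelve. all: by end_near.
Qed.

(** [log_pole z] is a branch of [- i * log (iline z)], an antiderivative of
    [pole z]. *)
Definition log_pole z (w : R) : C :=
  Complex (atan ((w - Im z) / - Re z)) (- (2^-1 * ln (normsq (iline z w)))).

Lemma normsq_iline_gt0 z w : Re z < 0 -> 0 < normsq (iline z w).
Proof. by move=> z0; apply/normsq_gt0/iline_neq0. Qed.

Lemma cder_log_pole z : Re z < 0 -> cder (log_pole z) (pole z).
Proof.
move=> z0 x; rewrite /pole ReV ImV.
have n_gt0 := normsq_iline_gt0 x z0.
have [dr di] := cder_iline z x.
split => /=.
  have dl : is_derive x 1 (fun w => (w - Im z) * (- Re z)^-1) (- Re z)^-1.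
    apply: (is_derive_eq (is_deriveM
      (is_deriveB (is_derive_id x 1) (is_derive_cst (Im z) x 1))
      (is_derive_cst ((- Re z)^-1) x 1))).
    by rewrite /GRing.scale /= mulr0 add0r subr0 mulr1.
  apply: (is_derive_eq (is_derive1_comp (is_derive1_atan _) dl)).
  move: n_gt0; rewrite /normsq; case: z z0 {dr di dl} => a b /= a0 n0.
  have a00 : a != 0 by rewrite lt_eqF.
  field; rewrite a00 andbT /= -!expr2.
  by move: n0; rewrite sub0r -!expr2 => /gt_eqF ->.
have dn : is_derive x 1 (fun w => normsq (iline z w)) (2 * Im (iline z x)).
  apply: (is_derive_eq (is_deriveD (is_deriveM dr dr) (is_deriveM di di))).
  by rewrite /GRing.scale /=; ring.
have dl := @is_derive1_comp R (@ln R) (fun w => normsq (iline z w)) x _ _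
  (is_derive1_ln n_gt0) dn.
have d2 := is_deriveN (is_deriveZ (2^-1 : R) dl).
apply: (is_derive_eq d2); rewrite /GRing.scale /=.
move: n_gt0; rewrite -[X in _ / X]/(normsq (iline z x)) => /gt_eqF/negbT n0.
by field; rewrite n0.
Qed.

(** Each logarithm diverges, but in their difference the arguments have the same
    limits and the quotient of the moduli tends to one. *)
Lemma zero_mean_poleB z y : Re z < 0 -> Re y < 0 ->
  zero_mean (fun w => pole z w - pole y w).
Proof.
move=> z0 y0; exists (fun w => log_pole z w + -1 * log_pole y w).
have Rlim : forall (F : set_system R) (FF : Filter F) (l : R),
    (forall a b : R, 0 < a -> atan ((w - b) / a) @[w --> F] --> l) ->
    czero F (pole y) ->
    czero F (fun w => log_pole z w + -1 * log_pole y w).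
  move=> F FF l atanF yF; split.
    have -> : (fun w => Re (log_pole z w + -1 * log_pole y w))
       = (fun w => atan ((w - Im z) / - Re z) - atan ((w - Im y) / - Re y)).
      by apply/funext => w; rewrite mulN1r ReD.
    by rewrite -[0](subrr l); apply: cvgB; apply: atanF; rewrite oppr_gt0.
  have [c1 c2] := czeroZ (y - z) yF.
  have -> : (fun w => Im (log_pole z w + -1 * log_pole y w))
     = (fun w => - (2^-1 * ln (normsq (1 + (y - z) * pole y w)))).
    apply/funext => w; rewrite mulN1r ImD.
    have q : iline z w = (1 + (y - z) * pole y w) * iline y w.
      rewrite mulrDl /pole mulfVK ?iline_neq0 // mul1r /iline.
      by rewrite addrA subrK.
    have yn := normsq_iline_gt0 w y0; have zn := normsq_iline_gt0 w z0.
    have qn : 0 < normsq (1 + (y - z) * pole y w).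
      by move: zn; rewrite {1}q normsqM pmulr_lgt0.
    by rewrite /= q normsqM lnM ?posrE //; ring.
  rewrite -[0]oppr0 -[in X in _ --> X](mulr0 (2^-1)) -(@ln1 R).
  apply: cvgN; apply: cvgM; first exact: cvg_cst.
  apply: continuous_cvg; first exact: continuous_ln.
  have -> : (fun w => normsq (1 + (y - z) * pole y w))
     = (fun w => (1 + Re ((y - z) * pole y w)) * (1 + Re ((y - z) * pole y w))
               + Im ((y - z) * pole y w) * Im ((y - z) * pole y w)).
    by apply/funext => w; rewrite /normsq ReD ImD /= add0r.
  have c3 : 1 + Re ((y - z) * pole y w) @[w --> F] --> (1 + 0 : R).
    by apply: cvgD => //; exact: cvg_cst.
  have := cvgD (cvgM c3 c3) (cvgM c2 c2).
  by rewrite !addr0 mul1r mulr0 addr0 => /(_ FF FF FF).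
have [yp yn] := czero_poleT y0.
split; last 2 first.
- exact: (Rlim _ _ (pi / 2) (fun a b a0 => atan_line_pinfty b a0)).
- exact: (Rlim _ _ (- (pi / 2)) (fun a b a0 => atan_line_ninfty b a0)).
have dz := cder_log_pole z0; have dy := cder_log_pole y0.
apply: cder_ext (cderD dz (cderM (cder_cst (-1)) dy)) => // w /=.
by rewrite mul0r add0r mulN1r.
Qed.

Definition poles (zs : seq C) (w : R) : C := \prod_(z <- zs) pole z w.

(** For two distinct roots,
    [1 / ((s - z) (s - y)) = (1 / (s - z) - 1 / (s - y)) / (z - y)] lowers the
    number of factors by one; what remains are powers of a single pole and
    differences of two simple poles. *)
Lemma zero_mean_poles zs : (1 < size zs)%N -> (forall z, z \in zs -> Re z < 0) ->
  zero_mean (poles zs).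
Proof.
move: {2}(size zs) (leqnn (size zs)) => n; elim: n zs => [|n IHn] zs.
  by rewrite leqn0 => /eqP ->.
case: zs => [//|z zs] szn sz2 neg.
have z0 : Re z < 0 by apply: neg; rewrite inE eqxx.
have [allz|] := boolP (all (pred1 z) zs).
  have [k kE] : exists k, size zs = k.+1 by exists (size zs).-1; rewrite prednK.
  have -> : zs = nseq k.+1 z by rewrite -kE; apply/all_pred1P.
  apply: zero_mean_ext (zero_mean_poleX k z0) => w.
  by rewrite /poles -[_ :: _]/(nseq k.+2 z) big_nseq iter_mulr_1.
rewrite -has_predC => /hasP[y yzs /= yz].
have y0 : Re y < 0 by apply: neg; rewrite inE yzs orbT.
pose rest := rem y zs.
have szr : size zs = (size rest).+1 by rewrite (perm_size (perm_to_rem yzs)).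
have restneg x : x \in rest -> Re x < 0.
  by move/mem_rem => xzs; apply: neg; rewrite inE xzs orbT.
have polesE w : poles (z :: zs) w = pole z w * (pole y w * poles rest w).
  by rewrite /poles big_cons (perm_big _ (perm_to_rem yzs)) big_cons.
have zy : z - y != 0 by rewrite subr_eq0 eq_sym.
have split_w w : pole z w * pole y w = (z - y)^-1 * (pole z w - pole y w).
  have h1 := iline_neq0 w z0; have h2 := iline_neq0 w y0.
  have e : z - y = iline y w - iline z w by rewrite /iline; ring.
  move: zy; rewrite e /pole => zy; field.
  by rewrite h1 h2 zy.
have [r0|r0] := posnP (size rest).
  apply: zero_mean_ext (zero_meanZ (z - y)^-1 (zero_mean_poleB z0 y0)) => w.
  by rewrite polesE (size0nil r0) /poles big_nil mulr1 split_w.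
have zm x : Re x < 0 -> zero_mean (poles (x :: rest)).
  move=> x0; apply: IHn => //=; last by move=> t; rewrite inE => /predU1P[->|/restneg].
  by rewrite -szr.
have zm2 := zero_meanD (zm z z0) (zero_meanZ (-1) (zm y y0)).
apply: zero_mean_ext (zero_meanZ (z - y)^-1 zm2) => w.
rewrite polesE mulrA split_w /poles !big_cons; ring.
Qed.

(** Dividing [a] by the linear factors one at a time leaves constants over
    products of poles.  As [a] has fewer coefficients than there are factors, a
    nonzero constant never meets a single factor. *)
Lemma zero_mean_ratio (zs : seq C) (a : {poly C}) :
  (forall z, z \in zs -> Re z < 0) -> (size a < size zs)%N ->
  zero_mean (fun w => a.[Complex 0 w] * poles zs w).
Proof.
elim: zs a => [//|z zs IHzs] a neg sza.
have z0 : Re z < 0 by apply: neg; rewrite inE eqxx.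
have negs x : x \in zs -> Re x < 0 by move=> xzs; apply: neg; rewrite inE xzs orbT.
have [->|a0] := eqVneq a 0.
  by apply: zero_mean_ext zero_mean0 => w; rewrite horner0 mul0r.
have aE : a = (a %/ ('X - z%:P)) * ('X - z%:P) + (a.[z])%:P.
  by rewrite {1}(divp_eq a ('X - z%:P)) modp_XsubC.
set q := a %/ _ in aE.
have szq : (size q < size zs)%N.
  rewrite size_divp ?polyXsubC_eq0 // size_XsubC subn1 /=.
  by move: sza a0; rewrite -size_poly_gt0 /=; case: (size a).
have zm : zero_mean (poles (z :: zs)).
  apply: zero_mean_poles => //; apply: leq_ltn_trans sza.
  by rewrite size_poly_gt0.
apply: zero_mean_ext (zero_meanD (IHzs q negs szq) (zero_meanZ a.[z] zm)) => w.
have h1 := iline_neq0 w z0.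
rewrite [in RHS]aE !hornerE /poles !big_cons /pole -/(iline z w) !mulrDl.
by rewrite -[_ * iline z w * _]mulrA mulVKf.
Qed.

End ComplexValued.

(** * Comparison of integrals over the line *)

Section IntegralComparison.
Context {R : realType}.
Local Notation mu := (@lebesgue_measure R).

(** Compare on the intervals [- n, n], where the integral of [d] is
    [U n - U (- n)], and let [n] tend to infinity. *)
Lemma le_integral_zero_mean (g1 g2 d U : R -> R) :
  continuous g1 -> continuous g2 -> continuous d ->
  (forall w, 0 <= g1 w) -> (forall w, 0 <= g2 w) ->
  (forall w : R, is_derive w (1 : R) U (d w)) ->
  U w @[w --> +oo] --> (0 : R) -> U w @[w --> -oo] --> (0 : R) ->
  (forall w, g1 w + d w <= g2 w) ->
  (\int[mu]_(w in [set: R]) (g1 w)%:E <= \int[mu]_(w in [set: R]) (g2 w)%:E)%E.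
Proof.
move=> c1 c2 cd g10 g20 dU Up Un g12.
(* [n.+1] keeps the intervals nondegenerate *)
pose I (n : nat) : set R := `[- n.+1%:R, n.+1%:R].
have mI n : @measurable _ (measurableTypeR R) (I n) by exact: measurable_itv.
have intI (g : R -> R) n : continuous g -> mu.-integrable (I n) (EFin \o g).
  move=> cg; apply: continuous_compact_integrable; first exact: segment_compact.
  by apply: continuous_subspaceT.
have mE (g : R -> R) (A : set R) : continuous g -> measurable_fun A (EFin \o g).
  move=> cg; apply/measurable_EFinP/measurable_funTS.
  exact: continuous_measurable_fun.
have ftc n : (\int[mu]_(w in I n) (d w)%:E)%E = (U n.+1%:R - U (- n.+1%:R))%:E.
  rewrite (@continuous_FTC2 _ d U).
  - by rewrite EFinB.
  - by rewrite gtrN // ltr0n.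
  - by apply: continuous_subspaceT.
  - have cU : continuous U.
      move=> x; apply: differentiable_continuous; apply/derivable1_diffP.
      by have [] := dU x.
    split.
    + by move=> x _; have [] := dU x.
    + exact/cvg_at_right_filter/cU.
    + exact/cvg_at_left_filter/cU.
  - by move=> x _; rewrite derive1E; have [_ ->] := dU x.
have bound n : ((\int[mu]_(w in I n) (g1 w)%:E)
    + (U n.+1%:R - U (- n.+1%:R))%:E <= \int[mu]_(w in [set: R]) (g2 w)%:E)%E.
  rewrite -ftc -integralD //; try exact: intI.
  apply: (@le_trans _ _ (\int[mu]_(w in I n) (g2 w)%:E)%E).
    apply: le_integral; first exact: mI.
    + exact: (integrableD (mI n) (intI g1 n c1) (intI d n cd)).
    + exact: intI.
    by move=> w _; rewrite -EFinD lee_fin.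
  apply: ge0_subset_integral => //; first exact: mE.
  by move=> w _; rewrite lee_fin.
have bigI : \bigcup_n I n = [set: R].
  apply/seteqP; split => // x _; exists (Num.truncn `|x|) => //=.
  rewrite /I /= in_itv /= -ler_norml ltW //.
  by have := truncnS_gt `|x|.
have lim1 : (\int[mu]_(w in I n) (g1 w)%:E)%E @[n --> \oo]
    --> (\int[mu]_(w in [set: R]) (g1 w)%:E)%E.
  rewrite -bigI; apply: ge0_nondecreasing_set_cvg_integral => //.
  - apply/nondecreasing_seqP => n; rewrite subsetEset => x /=.
    by rewrite /I /= !in_itv /= -!ler_norml => /le_trans; apply; rewrite ler_nat.
  - by move=> n; exact: mE.
  - by move=> n x _; rewrite lee_fin.
have limU : (U n.+1%:R - U (- n.+1%:R))%:E @[n --> \oo] --> (0%E : \bar R).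
  apply: cvg_EFin; first exact: nearW.
  rewrite -[X in _ --> X](subrr (0 : R)).
  have nS : n.+1%:R @[n --> \oo] --> (+oo : set_system R).
    apply/cvgryPgt => t; near=> n.
    rewrite (@lt_le_trans _ _ n%:R) ?ler_nat //; near: n; exact: nbhs_infty_gtr.
  have nN : - n.+1%:R @[n --> \oo] --> (-oo : set_system R).
    apply/cvgrNyPlt => t; near=> n.
    rewrite ltrNl (@lt_le_trans _ _ n%:R) ?ler_nat //; near: n; exact: nbhs_infty_gtr.
  by apply: cvgB; [exact: cvg_comp nS Up|exact: cvg_comp nN Un].
have fin0 : (0%E : \bar R) \is a fin_num by [].
have lim2 : (\int[mu]_(w in I n) (g1 w)%:E
      + (U n.+1%:R - U (- n.+1%:R))%:E)%E @[n --> \oo]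
    --> (\int[mu]_(w in [set: R]) (g1 w)%:E)%E.
  by rewrite -[X in _ --> X]adde0; exact: (cvgeD (fin_num_adde_defl _ fin0) lim1 limU).
by apply: (cvge_to_le lim2); apply: nearW.
Unshelve. all: by end_near.
Qed.

End IntegralComparison.

(** * Rational functions on the imaginary axis *)

Section ImaginaryAxis.
Context {R : realType}.
Local Notation ratfun := {fraction {poly R}}.
Local Notation C := R[i].
Local Notation tofrac := (@FracField.tofrac {poly R}).
Local Notation iw w := (Complex 0 w : C).

Lemma cder_poly (p : {poly C}) : exists p', cder (fun w : R => p.[iw w]) p'.
Proof.
elim/poly_ind: p => [|p c [p' dp]].
  by exists (fun=> 0); apply: cder_ext (cder_cst 0) => w //=; rewrite horner0.
have di : cder (fun w : R => iw w) (fun=> Complex 0 1).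
  by move=> x; split; [exact: is_derive_cst|exact: is_derive_id].
eexists; apply: cder_ext (cderD (cderM dp di) (cder_cst c)) => w //=.
by rewrite !hornerE.
Qed.

Lemma sps_cder (f : ratfun) : sps f ->
  exists f', cder (fun w : R => rateval f (iw w)) f'.
Proof.
move=> [a [b [bst _ fE]]].
have [a' da] := cder_poly (map_poly (real_complex R) a).
have [b' db] := cder_poly (map_poly (real_complex R) b).
have bw w : (map_poly (real_complex R) b).[iw w] != 0 by exact: bst.
eexists; apply: cder_ext (cderM da (cderV bw db)) => w //.
by symmetry; apply: ratvalE; exists a, b.
Qed.

(** If both [f] and [s f] are strictly proper, then [f] has relative degree at
    least two. *)
Lemma sps_zero_mean (f : ratfun) : sps f -> sps (ratvar * f) ->
  zero_mean (fun w : R => rateval f (iw w)).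
Proof.
move=> [a [b [bst ab fE]]] [c [d [dst cd sfE]]].
have b0 := stable_poly_neq0 bst; have d0 := stable_poly_neq0 dst.
have cross : 'X * a * d = c * b.
  apply/eqP; rewrite -tofrac_eq !tofracM; apply/eqP; apply: eq_div_cross.
  - by rewrite tofrac_eq0.
  - by rewrite tofrac_eq0.
  - by rewrite -sfE fE mulrA.
have szab : (a == 0) || ((size a).+1 < size b)%N.
  have [//|a0] /= := eqVneq a 0.
  have Xa0 : 'X * a != 0 by rewrite mulf_neq0 ?polyX_eq0.
  have c0 : c != 0.
    by apply: contraNneq (mulf_neq0 Xa0 d0) => c0; rewrite cross c0 mul0r.
  have := congr1 (fun q : {poly R} => size q) cross.
  rewrite (size_mul Xa0 d0) (size_mul c0 b0) ['X * a]mulrC size_mulX //.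
  rewrite -size_poly_gt0 in d0; rewrite -size_poly_gt0 in b0.
  move: cd d0 b0; case: (size d) (size b) => [|sd] [|sb] //.
  rewrite !addnS /= addSn ltnS => cd _ _ e; rewrite ltnS -(ltn_add2r sd) e.
  by rewrite [(sb + sd)%N]addnC leq_add2r.
pose bC := map_poly (real_complex R) b.
have [zs bE] := closed_field_poly_normal bC.
have lc0 : lead_coef bC != 0 by rewrite lead_coef_eq0 map_poly_eq0.
have zneg z : z \in zs -> complex.Re z < 0.
  move=> zzs; rewrite ltNge; apply/negP => /bst/eqP; apply.
  by rewrite -/bC bE hornerZ (rootP _) ?mulr0 // root_prod_XsubC.
have szb : size b = (size zs).+1.
  have <- : size bC = size b by rewrite size_map_poly.
  by rewrite bE size_scale // size_prod_XsubC.
have [a00|a0] := eqVneq a 0.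
  apply: zero_mean_ext zero_mean0 => w; symmetry; apply: ratvalE.
  exists 0, b; split; [exact: bst|by rewrite fE a00|].
  by rewrite map_poly0 horner0 mul0r.
have sza : (size (map_poly (real_complex R) a) < size zs)%N.
  by rewrite size_map_poly; move: szab; rewrite (negbTE a0) szb ltnS.
apply: zero_mean_ext (zero_meanZ (lead_coef bC)^-1 (zero_mean_ratio zneg sza)) => w.
symmetry; apply: ratvalE; exists a, b; split; [exact: bst|by []|].
rewrite -/bC mulrCA; congr (_ * _); rewrite [in RHS]bE hornerZ invfM; congr (_ * _).
by rewrite horner_prod /poles -prodfV; apply: eq_bigr => z _; rewrite !hornerE.
Qed.

End ImaginaryAxis.

(** * The controller built from the local feedbacks *)

Section ConstantMatrices.
Context {R : realType}.

Lemma cstmxM m n k (M : 'M[R]_(m, n)) (N : 'M[R]_(n, k)) :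
  cstmx (M *m N) = cstmx M *m cstmx N.
Proof. exact: map_mxM. Qed.

Lemma cstmxD m n (M N : 'M[R]_(m, n)) : cstmx (M + N) = cstmx M + cstmx N.
Proof. exact: map_mxD. Qed.

Lemma cstmxN m n (M : 'M[R]_(m, n)) : cstmx (- M) = - cstmx M.
Proof. exact: map_mxN. Qed.

Lemma cstmx1 n : cstmx (1%:M : 'M[R]_n) = 1%:M.
Proof. exact: map_mx1. Qed.

Lemma cstmx0 m n : cstmx (0 : 'M[R]_(m, n)) = 0.
Proof. exact: map_mx0. Qed.

Lemma incidence_cstmx p (le : rel 'I_p) (r c : 'I_p -> nat)
    (M : 'M[R]_(\sum_i r i, \sum_j c j)) :
  incidence le M -> incidence le (cstmx M).
Proof.
move=> Minc i j /Minc M0; apply/matrixP => a b.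
by have := congr1 (fun N : 'M[R]_(r i, c j) => ratcst (N a b)) M0; rewrite !mxE rmorph0.
Qed.

End ConstantMatrices.

Section HurwitzTransfer.
Context {R : realType}.
Local Notation cmx := (map_mx (real_complex R)).

Lemma hurwitz_similar n k (N : 'M[R]_n) (M : 'M[R]_k) (V : 'M[R]_(n, k))
    (W : 'M[R]_(k, n)) :
  V *m W = 1%:M -> W *m V = 1%:M -> M = W *m N *m V -> hurwitz N -> hurwitz M.
Proof.
move=> VW WV ME Nhur z /eigenvalueP[v vM v0]; apply: Nhur.
apply/eigenvalueP; exists (v *m cmx W).
  rewrite scalemxAl -vM ME -!mulmxA -!map_mxM; congr (_ *m cmx _).
  by rewrite -!mulmxA VW mulmx1.
apply: contraNneq v0 => vW; rewrite -[v]mulmx1 -(map_mx1 (real_complex R)) -WV.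
by rewrite map_mxM mulmxA vW mul0mx.
Qed.

Lemma hurwitz_bdiag p (d : 'I_p -> nat) (M : forall j, 'M[R]_(d j)) :
  (forall j, hurwitz (M j)) -> hurwitz (bdiag M).
Proof.
move=> Mhur z /eigenvalueP[v vM v0].
have [j vj0] : exists j, v *m cmx (tallE R d j) != 0.
  apply/existsP; rewrite -negb_forall; apply: contra v0 => /forallP vj.
  apply/eqP/(@eq_by_tallE _ _ _ _ _ _) => j; rewrite mul0mx.
  by rewrite -(map_tallE (real_complex R)); apply/eqP/vj.
apply: (Mhur j); apply/eigenvalueP; exists (v *m cmx (tallE R d j)) => //.
by rewrite -mulmxA -map_mxM -mul_bdiag_tallE map_mxM mulmxA vM scalemxAl.
Qed.

End HurwitzTransfer.

Section Controller.
Context {R : realType} {p : nat}.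
Variables (le : rel 'I_p) (n m : 'I_p -> nat) (l : nat).
Variables (A : 'M[R]_(\sum_i n i)) (B : 'M[R]_(\sum_i n i, \sum_i m i))
  (D : 'M[R]_(l, \sum_i m i)) (X : forall j : 'I_p, 'M[R]_(ddim le n j)).
Hypothesis le_poset : poset_on le.
Hypotheses (Ainc : incidence le A) (Binc : incidence le B).

Local Notation ratfun := {fraction {poly R}}.
Local Notation Rn := (Rmx le R n).
Local Notation P1 := (Pi1 le R n).
Local Notation P2 := (Pi2 le R n).
Local Notation bA := (boldA A B D X).
Local Notation CQ := (C_Q B D X).
Local Notation CPhi := (C_Phi (R := R) le n).
Local Notation Ac := (A_Phi A B D X - B_Phi A B D X *m CPhi).
Local Notation Bc := (B_Phi A B D X).
Local Notation Ks := (Kstar A B D X).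
Local Notation Acl j :=
  (down_block le A j - down_block le B j *m ric_gain B D X j).

Lemma C_Q_tallE j : CQ *m tallE R (ddim le n) j
  = - (downE R le m j *m ric_gain B D X j).
Proof.
by rewrite /C_Q !mulNmx -mulmxA mul_bdiag_tallE mulmxA Rmx_tallE.
Qed.

(** Each downset carries an invariant subspace of [A] and [B], so [Rn], which
    sums the local copies of the state, intertwines the local dynamics with that
    of the plant. *)
Lemma Rmx_boldA : Rn *m bA = A *m Rn + B *m CQ.
Proof.
apply: eq_by_tallE => j; rewrite mulmxDl -(mulmxA A) -(mulmxA B) C_Q_tallE.
rewrite -(mulmxA _ bA) mul_bdiag_tallE (mulmxA Rn) Rmx_tallE mulmxN (mulmxA B).
by rewrite !incidence_downE // mulmxBr !mulmxA.
Qed.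

(** The closed-loop coordinates: from the plant state [x] and the controller state
    [q] one recovers the local states [Pi1 (x - C_Phi q) + Pi2 q]. *)
Definition to_local : 'M[R]_(\sum_j ddim le n j, _) :=
  row_mx P1 (P2 - P1 *m CPhi).

Definition of_local : 'M[R]_(_, \sum_j ddim le n j) := col_mx Rn P2^T.

Lemma to_localK : to_local *m of_local = 1%:M.
Proof.
have [_ _ PP RP1] := Pi_split R le_poset n.
have RPP : Rn *m P2 *m P2^T = Rn - P1^T.
  by rewrite -mulmxA -[P2 *m _](addKr (P1 *m P1^T)) PP mulmxDr mulmxN mulmx1
    mulmxA RP1 mul1mx addrC.
rewrite mul_row_col mulmxBl /C_Phi -(mulmxA P1) RPP mulmxBr -PP.
by rewrite opprB [P2 *m _ + _]addrC addrA [P1 *m Rn + _]addrC subrK.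
Qed.

Lemma of_localK : of_local *m to_local = 1%:M.
Proof.
have [P22 P21 _ RP1] := Pi_split R le_poset n.
rewrite mul_col_row !mulmxBr (mulmxA Rn P1) (mulmxA P2^T P1) RP1 P22 P21.
rewrite mul1mx mul0mx subr0.
by rewrite /C_Phi subrr -scalar_mx_block.
Qed.

(** In these coordinates the interconnection of plant and controller is the
    direct sum of the local closed loops. *)
Lemma loop_similar :
  block_mx (A + B *m (CQ *m P1)) (B *m (CQ *m (P2 - P1 *m CPhi))) Bc Ac
    = of_local *m bA *m to_local.
Proof.
have [_ _ _ RP1] := Pi_split R le_poset n.
rewrite mul_col_mx mul_col_row Rmx_boldA !mulmxDl -!mulmxA RP1 mulmx1.
have -> : Rn *m (P2 - P1 *m CPhi) = 0.
  by rewrite mulmxBr mulmxA RP1 mul1mx subrr.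
rewrite mulmx0 add0r /B_Phi /A_Phi; congr block_mx; rewrite ?mulmxA //.
by rewrite mulmxBr !mulmxA.
Qed.

Lemma stabilizing_Kstar : (forall j, hurwitz (Acl j)) -> stabilizing A B Ks.
Proof.
move=> Ahur; exists _, Ac, Bc, (CQ *m (P2 - P1 *m CPhi)), (CQ *m P1); split=> //.
rewrite loop_similar; apply: hurwitz_similar to_localK of_localK erefl _.
exact: hurwitz_bdiag.
Qed.

(** The initial value of the local states is [Pi1], since a disturbance of the
    [j]-th state enters the first block of the downset of [j] only. *)
Definition local_resp : 'M[ratfun]_(_, _) := invmx (smx bA) *m cstmx P1.

Lemma s_local_resp :
  ratvar *: local_resp = cstmx bA *m local_resp + cstmx P1.
Proof.
rewrite -[X in _ + X]mul1mx -(mulmxV (smx_unitmx bA)) -mulmxA -/local_resp.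
by rewrite /smx mulmxBl mul_scalar_mx addrC subrK.
Qed.

(** With [x] the plant state, the controller state [q] collects the components
    of the local states selected by [Pi2]; [x] and [q] give back all local states,
    to which the output of the controller applies the local gains. *)
Lemma Kstar_response :
  Ks *m (cstmx Rn *m local_resp) = cstmx CQ *m local_resp.
Proof.
have [_ P21 _ _] := Pi_split R le_poset n.
set T := cstmx Rn *m local_resp; pose q := cstmx P2^T *m local_resp.
have split_resp : local_resp = cstmx P1 *m T + cstmx (P2 - P1 *m CPhi) *m q.
  rewrite /T /q (mulmxA (cstmx P1)) (mulmxA (cstmx (P2 - _))) -!cstmxM.
  rewrite -mulmxDl -cstmxD -mul_row_col -/to_local -/of_local to_localK.
  by rewrite cstmx1 mul1mx.
have sq : smx Ac *m q = cstmx Bc *m T.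
  rewrite /smx mulmxBl mul_scalar_mx {1}/q scalemxAr s_local_resp mulmxDr.
  rewrite -[X in _ + X - _]cstmxM P21 cstmx0 addr0 {1}split_resp.
  have -> : Ac = P2^T *m bA *m (P2 - P1 *m CPhi).
    by rewrite mulmxBr /A_Phi /B_Phi !mulmxA.
  rewrite (mulmxA (cstmx P2^T)) -cstmxM mulmxDr (mulmxA _ (cstmx P1)).
  by rewrite (mulmxA _ (cstmx (P2 - _))) -!cstmxM addrK.
have qE : q = invmx (smx Ac) *m (cstmx Bc *m T).
  by rewrite -sq mulKmx // smx_unitmx.
rewrite split_resp /Kstar /ss_tf -/(smx Ac) mulmxDl.
rewrite -(mulmxA _ (cstmx Bc) T) -(mulmxA _ _ (_ *m T)) -qE addrC mulmxDr.
by rewrite !(mulmxA (cstmx CQ)) -!cstmxM.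
Qed.

Lemma loopmx_Kstar : loopmx A B Ks *m (cstmx Rn *m local_resp) = 1%:M.
Proof.
have [_ _ _ RP1] := Pi_split R le_poset n.
set T := cstmx Rn *m local_resp.
have sT : ratvar *: T = cstmx A *m T + cstmx B *m (cstmx CQ *m local_resp) + 1%:M.
  rewrite /T scalemxAr s_local_resp mulmxDr (mulmxA _ (cstmx bA)) -!cstmxM RP1.
  rewrite Rmx_boldA cstmxD cstmx1 mulmxDl (mulmxA (cstmx A)) (mulmxA (cstmx B)).
  by rewrite !cstmxM.
rewrite /loopmx mulmxBl /smx mulmxBl mul_scalar_mx sT -(mulmxA _ Ks).
rewrite Kstar_response -addrA -opprD.
by rewrite [X in X - _]addrC addrK.
Qed.

Lemma invmx_loopmx_Kstar :
  invmx (loopmx A B Ks) = cstmx Rn *m local_resp.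
Proof. exact: mulmx1_invmx loopmx_Kstar. Qed.

(** The local loops are decoupled, and column [j] of [Pi1] enters the [j]-th. *)
Lemma local_resp_tallE j : local_resp *m tallE ratfun n j
  = tallE ratfun (ddim le n) j
    *m (invmx (smx (Acl j)) *m cstmx (pid_mx (n j) : 'M[R]_(ddim le n j, n j))).
Proof.
have cst_tallE d k : cstmx (tallE R d k) = tallE ratfun d k by exact: map_tallE.
have Pj : cstmx P1 *m tallE ratfun n j
    = tallE ratfun (ddim le n) j *m cstmx (pid_mx (n j)).
  by rewrite -!cst_tallE -!cstmxM mul_bdiag_tallE.
have Sj : smx bA *m tallE ratfun (ddim le n) j
    = tallE ratfun (ddim le n) j *m smx (Acl j).
  rewrite /smx mulmxBl mulmxBr mul_scalar_mx mul_mx_scalar; congr (_ - _).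
  by rewrite -!cst_tallE -!cstmxM mul_bdiag_tallE.
rewrite /local_resp -mulmxA Pj mulmxA [RHS]mulmxA; congr (_ *m _).
rewrite -[RHS](mulKmx (smx_unitmx bA)) (mulmxA (smx bA)) Sj -!mulmxA.
by rewrite mulmxV ?smx_unitmx // mulmx1.
Qed.

(** For a disturbance of the [j]-th state, plant and controller act as the local
    closed loop of the downset of [j]. *)
Lemma state_resp_tallE j : exists2 Y : 'M[ratfun]_(ddim le n j, n j),
  invmx (loopmx A B Ks) *m tallE ratfun n j = downE ratfun le n j *m Y &
  Ks *m invmx (loopmx A B Ks) *m tallE ratfun n j
    = - (downE ratfun le m j *m (cstmx (ric_gain B D X j) *m Y)).
Proof.
have cst_tallE d k : cstmx (tallE R d k) = tallE ratfun d k by exact: map_tallE.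
have cst_downE d k : cstmx (downE R le d k) = downE ratfun le d k by exact: map_downE.
eexists; rewrite invmx_loopmx_Kstar.
  rewrite -mulmxA local_resp_tallE mulmxA -cst_tallE -cstmxM Rmx_tallE.
  by rewrite cst_downE.
rewrite Kstar_response -mulmxA local_resp_tallE mulmxA -cst_tallE -cstmxM.
by rewrite C_Q_tallE cstmxN cstmxM cst_downE mulNmx -mulmxA.
Qed.

(** The two responses are in the incidence algebra, hence so is their quotient. *)
Lemma incidence_Kstar : incidence le Ks.
Proof.
have [Lu _] := mulmx1_unit loopmx_Kstar.
have Tinc : incidence le (invmx (loopmx A B Ks)).
  by apply: incidenceP => j; have [Y eY _] := state_resp_tallE j; exists Y.
have Minc : incidence le (Ks *m invmx (loopmx A B Ks)).
  apply: incidenceP => j; have [Y _ eY] := state_resp_tallE j.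
  by exists (- (cstmx (ric_gain B D X j) *m Y)); rewrite mulmxN.
exact: incidence_of_invmx le_poset Lu Tinc Minc.
Qed.

End Controller.

Lemma incidence_loopmx (R : realType) p (le : rel 'I_p) (n m : 'I_p -> nat)
    (A : 'M[R]_(\sum_i n i)) (B : 'M[R]_(\sum_i n i, \sum_i m i))
    (K : 'M[{fraction {poly R}}]_(\sum_i m i, \sum_i n i)) :
  poset_on le -> incidence le A -> incidence le B -> incidence le K ->
  incidence le (loopmx A B K).
Proof.
move=> le_poset Ainc Binc Kinc i j nji.
have [le_refl _ _ _] := le_poset.
rewrite /loopmx /smx !submxblockB (incidence_cstmx Ainc) // subr0.
rewrite (incidence_mul le_poset (incidence_cstmx Binc) Kinc) // subr0.
rewrite submxblock_tallE mul_mx_scalar -scalemxAl tallE_orth ?scaler0 //.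
by apply: contraNneq nji => ->.
Qed.

(** * Stabilizability of the downset systems *)

Section BlockStabilizability.
Context {R : realType} {p : nat}.
Variables (le : rel 'I_p) (n m : 'I_p -> nat).
Variables (A : 'M[R]_(\sum_i n i)) (B : 'M[R]_(\sum_i n i, \sum_i m i)).
Hypothesis le_poset : poset_on le.
Local Notation cmx := (map_mx (real_complex R)).

Lemma row_last_block (c : 'I_p -> nat) (Y : 'M[R]_(\sum_i n i, \sum_i c i)) (k : 'I_p)
    (v : 'rV[R[i]]_(\sum_i n i)) :
  incidence le Y ->
  (forall i : 'I_p, (k < i)%N -> v *m cmx (tallE R n i) = 0) ->
  v *m cmx Y *m cmx (tallE R c k)
    = v *m cmx (tallE R n k) *m cmx (submxblock Y k k).
Proof.
move=> Yinc vlast; have [_ _ _ le_nat] := le_poset.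
rewrite -[v in LHS]mulmx1 -(map_mx1 (real_complex R)) -sum_tallE.
rewrite map_mx_sum mulmx_sumr !mulmx_suml (bigD1 k) //= [X in _ + X]big1 ?addr0.
  by rewrite submxblock_tallE !map_mxM !mulmxA.
move=> i nik; rewrite map_mxM (mulmxA v) -(mulmxA _ (cmx _)) -!(mulmxA (v *m _)).
rewrite -!map_mxM mulmxA -submxblock_tallE.
have [ki|nki] := boolP (le k i); last by rewrite Yinc // map_mx0 mulmx0.
by rewrite vlast ?mul0mx // ltn_neqAle le_nat // andbT eq_sym.
Qed.

(** Of a left eigenvector that is orthogonal to the inputs keep the last nonzero
    block: by triangularity it has the same two properties for the corresponding
    diagonal blocks. *)
Lemma pbh_down_block j :
  incidence le A -> incidence le B ->
  (forall i, stabilizable (submxblock A i i) (submxblock B i i)) ->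
  pbh (down_block le A j) (down_block le B j).
Proof.
move=> Ainc Binc stab z w z_ge0 wA wB; apply/eqP; apply: contraT => w0.
pose E := downE R le n j; pose v := w *m cmx E^T.
have vE : v *m cmx E = w.
  by rewrite /v -mulmxA -map_mxM downE_tr_id map_mx1 mulmx1.
have vnz : exists k, v *m cmx (tallE R n k) != 0.
  apply/existsP; rewrite -negb_forall; apply: contra w0 => /forallP vj.
  have v0 : v = 0.
    apply: eq_by_tallE => k; rewrite mul0mx -(map_tallE (real_complex R)).
    exact/eqP/vj.
  by rewrite -vE v0 mul0mx.
have [k0 k0P] := vnz.
have [k vk kmax] :=
  @arg_maxnP _ k0 (fun k => v *m cmx (tallE R n k) != 0) (@nat_of_ord p) k0P.
have jk : le j k.
  apply: contraR vk => njk; apply/eqP.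
  have := tallE_tr_downE R n njk => /(congr1 trmx); rewrite trmx_mul trmxK trmx0.
  by rewrite /v -mulmxA -map_mxM => ->; rewrite map_mx0 mulmx0.
have vlast (i : 'I_p) : (k < i)%N -> v *m cmx (tallE R n i) = 0.
  by move=> ki; apply/eqP; apply: contraLR ki => /kmax; rewrite -leqNgt.
have downk (d c : 'I_p -> nat) (Y : 'M[R]_(\sum_i d i, \sum_i c i)) :
    incidence le Y -> Y *m tallE R c k
      = downE R le d j *m down_block le Y j *m ((downE R le c j)^T *m tallE R c k).
  by move=> Yinc; rewrite -incidence_downE // -mulmxA downE_proj.
have vkA : v *m cmx (tallE R n k) *m cmx (submxblock A k k)
    = z *: (v *m cmx (tallE R n k)).
  rewrite -row_last_block // -(mulmxA v) -map_mxM downk // -/E !map_mxM !mulmxA.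
  rewrite vE wA -!scalemxAl; congr (_ *: _).
have vkB : v *m cmx (tallE R n k) *m cmx (submxblock B k k) = 0.
  rewrite -row_last_block // -(mulmxA v) -map_mxM downk // -/E !map_mxM !mulmxA.
  by rewrite vE wB !mul0mx.
have [K Khur] := stab k.
suff : complex.Re z < 0 by rewrite ltNge z_ge0.
apply: Khur; apply/eigenvalueP; exists (v *m cmx (tallE R n k)) => //.
by rewrite map_mxD map_mxM mulmxDr mulmxA vkB mul0mx addr0.
Qed.

End BlockStabilizability.

(** * The cost of a controller *)

Section TraceLemmas.
Context {R : realType}.
Local Notation ratfun := {fraction {poly R}}.
Local Notation C := R[i].
Local Notation cmx := (map_mx (real_complex R)).

Lemma ratval_sum (I : finType) z (f : I -> ratfun) (v : I -> C) :
  (forall i, ratval z (f i) (v i)) -> ratval z (\sum_i f i) (\sum_i v i).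
Proof.
move=> fv; apply: (big_ind2 (ratval z)) => //.
  by have := ratval_cst z (0 : R); rewrite !rmorph0.
by move=> *; apply: ratvalD.
Qed.

Lemma sps_sum (I : finType) (f : I -> ratfun) :
  (forall i, sps (f i)) -> sps (\sum_i f i).
Proof.
by move=> fs; apply: big_ind => //; [exact: sps0|exact: spsD].
Qed.

Lemma trace_hadj_columns k p (q : 'I_p -> nat) (V : 'M[C]_(k, \sum_i q i)) :
  \tr (hadj V *m V)
    = \sum_j \tr (hadj (V *m cmx (tallE R q j)) *m (V *m cmx (tallE R q j))).
Proof.
rewrite -[hadj V *m V]mulmx1 -(map_mx1 (real_complex R)) -sum_tallE map_mx_sum.
rewrite mulmx_sumr linear_sum; apply: eq_bigr => j _ /=.
by rewrite map_mxM mulmxA mxtrace_mulC hadjM hadj_cmx !mulmxA.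
Qed.

Lemma Re_trace_hadj m n (V : 'M[C]_(m, n)) :
  complex.Re (\tr (hadj V *m V)) = \sum_j \sum_i normsq (V i j).
Proof.
rewrite /mxtrace (raddf_sum (@complex.Re R : Rcomplex R -> R)).
apply: eq_bigr => j _; rewrite mxE (raddf_sum (@complex.Re R : Rcomplex R -> R)).
apply: eq_bigr => i _; rewrite !mxE /normsq.
by case: (V i j) => a b /=; rewrite mulNr opprK.
Qed.

Lemma Re_trace_hadj_ge0 m n (V : 'M[C]_(m, n)) : 0 <= complex.Re (\tr (hadj V *m V)).
Proof.
rewrite Re_trace_hadj; apply: sumr_ge0 => j _; apply: sumr_ge0 => i _.
by rewrite /normsq -!expr2 addr_ge0 ?sqr_ge0.
Qed.
Lemma continuous_sum (I : Type) (r : seq I) (f : I -> R -> R) :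
  (forall i, continuous (f i)) -> continuous (fun w => \sum_(i <- r) f i w).
Proof.
move=> fc; elim: r => [|i r IHr].
  by under eq_fun do rewrite big_nil; move=> x; exact: cvg_cst.
under eq_fun do rewrite big_cons.
by move=> x; apply: cvgD; [exact: fc|exact: IHr].
Qed.

Lemma cder_continuous (f f' : R -> C) : cder f f' ->
  continuous (fun w => complex.Re (f w)) /\ continuous (fun w => complex.Im (f w)).
Proof.
move=> df; split => x; have [d1 d2] := df x;
  apply: differentiable_continuous; apply/derivable1_diffP.
- by case: d1.
- by case: d2.
Qed.

Lemma continuous_h2_density m n (G : 'M[ratfun]_(m, n)) : mxsps G ->
  continuous (fun w : R => complex.Re
    (\tr (hadj (tfeval G (Complex 0 w)) *m tfeval G (Complex 0 w)))).
Proof.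
move=> Gs; under eq_fun do rewrite Re_trace_hadj.
apply: continuous_sum => j; apply: continuous_sum => i.
have [f' /cder_continuous[c1 c2]] := sps_cder (Gs i j).
under eq_fun do rewrite mxE /normsq.
by move=> x; apply: cvgD; apply: cvgM; [exact: c1|exact: c1|exact: c2|exact: c2].
Qed.

End TraceLemmas.

Lemma subr_common (V : zmodType) (a b c a' c' : V) :
  a + b + c - (a' + b + c') = (a - a') + (c - c').
Proof.
by rewrite opprD addrACA; congr (_ + _); rewrite opprD addrACA subrr addr0.
Qed.

Section Cost.
Context {R : realType} {p : nat}.
Variables (le : rel 'I_p) (n m q : 'I_p -> nat) (l : nat).
Variables (A : 'M[R]_(\sum_i n i)) (B : 'M[R]_(\sum_i n i, \sum_i m i))
  (C : 'M[R]_(l, \sum_i n i)) (D : 'M[R]_(l, \sum_i m i))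
  (F : 'M[R]_(\sum_i n i, \sum_i q i)) (X : forall j : 'I_p, 'M[R]_(ddim le n j)).
Hypothesis le_poset : poset_on le.
Hypotheses (Ainc : incidence le A) (Binc : incidence le B).
Hypothesis (CD0 : C^T *m D = 0) (DDpos : posdef (D^T *m D)).
Hypothesis Fdiag : block_diagonal F.
Hypothesis Xpos : forall j, posdef (X j).
Hypothesis Xric : forall j, riccati_solution A B C D (X j).

Local Notation ratfun := {fraction {poly R}}.
Local Notation cmx := (map_mx (real_complex R)).
Local Notation En j := (downE R le n j).
Local Notation Em j := (downE R le m j).
Local Notation Eq j := (tallE R q j).
Local Notation Ad j := (down_block le A j).
Local Notation Bd j := (down_block le B j).
Local Notation Cd j := (down_cols le C j).
Local Notation Dd j := (down_cols le D j).
Local Notation Fd j := ((En j)^T *m F *m Eq j).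
Local Notation gain j := (ric_gain B D X j).

Lemma posdef_down j : posdef ((Dd j)^T *m Dd j).
Proof.
have [_ DDgt0] := DDpos.
have DE : (Dd j)^T *m Dd j = (Em j)^T *m (D^T *m D) *m Em j.
  by rewrite down_colsE trmx_mul !mulmxA.
split; first by rewrite trmx_mul trmxK.
move=> x x0; have Ex0 : Em j *m x != 0.
  apply: contraNneq x0 => Ex; rewrite -[x]mul1mx -(downE_tr_id R le m j) -mulmxA.
  by rewrite Ex mulmx0.
by have := DDgt0 _ Ex0; rewrite DE trmx_mul !mulmxA.
Qed.

Lemma down_CD0 j : (Cd j)^T *m Dd j = 0.
Proof.
by rewrite !down_colsE trmx_mul mulmxA -(mulmxA _ C^T) CD0 mulmx0 mul0mx.
Qed.

Definition state_resp (K : 'M[ratfun]_(\sum_i m i, \sum_i n i)) :=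
  invmx (loopmx A B K) *m cstmx F.
Definition input_resp (K : 'M[ratfun]_(\sum_i m i, \sum_i n i)) :=
  K *m invmx (loopmx A B K) *m cstmx F.
Definition down_state K j := cstmx (En j)^T *m state_resp K *m cstmx (Eq j).
Definition down_input K j := cstmx (Em j)^T *m input_resp K *m cstmx (Eq j).

Lemma cst_tallE (d : 'I_p -> nat) j : cstmx (tallE R d j) = tallE ratfun d j.
Proof. exact: map_tallE. Qed.

Lemma cst_downE (d : 'I_p -> nat) j : cstmx (downE R le d j) = downE ratfun le d j.
Proof. exact: map_downE. Qed.

Lemma incidence_F : incidence le (cstmx F).
Proof.
have [le_refl _ _ _] := le_poset.
apply: incidence_cstmx => i j nji; apply: Fdiag.
by apply: contraNneq nji => ->.
Qed.

Lemma incidence_column (d : 'I_p -> nat) (G : 'M[ratfun]_(\sum_i d i, \sum_i q i)) j :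
  incidence le G ->
  G *m cstmx (Eq j) = cstmx (downE R le d j)
    *m (cstmx (downE R le d j)^T *m G *m cstmx (Eq j)).
Proof.
move=> Ginc; rewrite -[cstmx (_^T)]map_trmx -/(cstmx (downE R le d j)).
rewrite cst_tallE cst_downE -(mulmxA _ G).
exact: incidence_tallE.
Qed.

Lemma down_mul (d : 'I_p -> nat) (M : 'M[R]_(\sum_i n i, \sum_i d i))
    (G : 'M[ratfun]_(\sum_i d i, \sum_i q i)) j : incidence le G ->
  cstmx (En j)^T *m (cstmx M *m G) *m cstmx (Eq j)
    = cstmx (down_block le M j)
        *m (cstmx (downE R le d j)^T *m G *m cstmx (Eq j)).
Proof.
move=> Ginc; rewrite -2!mulmxA (incidence_column j Ginc) down_blockE !cstmxM.
by rewrite !mulmxA.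
Qed.

Section OneController.
Variable K : 'M[ratfun]_(\sum_i m i, \sum_i n i).
Hypotheses (Kinc : incidence le K) (Kstab : stabilizing A B K).

Lemma loop_unit : loopmx A B K \in unitmx.
Proof. by have [] := stabilizing_loopmx Kstab. Qed.

Lemma incidence_state_resp : incidence le (state_resp K).
Proof.
apply: (incidence_mul le_poset _ incidence_F).
apply: (incidence_invmx le_poset loop_unit).
exact: incidence_loopmx.
Qed.

Lemma incidence_input_resp : incidence le (input_resp K).
Proof.
rewrite /input_resp -mulmxA; apply: (incidence_mul le_poset Kinc).
exact: incidence_state_resp.
Qed.

Lemma sps_state_resp : mxsps (state_resp K).
Proof. by apply: mxsps_cstr; have [] := stabilizing_loopmx Kstab. Qed.

Lemma sps_input_resp : mxsps (input_resp K).
Proof. by apply: mxsps_cstr; have [] := stabilizing_loopmx Kstab. Qed.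

Lemma s_state_resp :
  ratvar *: state_resp K = cstmx A *m state_resp K + cstmx F + cstmx B *m input_resp K.
Proof.
rewrite /state_resp scalemxAl (s_invmx_loopmx loop_unit) !mulmxDl mul1mx.
by rewrite -!(mulmxA (cstmx _)).
Qed.

Lemma closed_loop_resp :
  closed_loop A B C D F K = cstmx C *m state_resp K + cstmx D *m input_resp K.
Proof.
by rewrite (closed_loopE _ _ _ loop_unit) mulmxDl /state_resp /input_resp !mulmxA.
Qed.

Lemma sps_closed_loop : mxsps (closed_loop A B C D F K).
Proof.
rewrite closed_loop_resp; apply: mxspsD; apply: mxsps_cstl.
  exact: sps_state_resp.
exact: sps_input_resp.
Qed.

Lemma s_down_state j :
  ratvar *: down_state K j
    = cstmx (Ad j) *m down_state K j + cstmx (Fd j) + cstmx (Bd j) *m down_input K j.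
Proof.
rewrite {1}/down_state scalemxAl scalemxAr s_state_resp !mulmxDr !mulmxDl.
rewrite (down_mul _ _ incidence_state_resp) (down_mul _ _ incidence_input_resp).
by rewrite !cstmxM.
Qed.

Lemma closed_loop_column j :
  closed_loop A B C D F K *m cstmx (Eq j)
    = cstmx (Cd j) *m down_state K j + cstmx (Dd j) *m down_input K j.
Proof.
rewrite closed_loop_resp mulmxDl -(mulmxA (cstmx C)) -(mulmxA (cstmx D)).
rewrite (incidence_column j incidence_state_resp).
rewrite (incidence_column j incidence_input_resp).
by rewrite !down_colsE !cstmxM -!(mulmxA (cstmx C)) -!(mulmxA (cstmx D)).
Qed.

Lemma sps_down_state j : mxsps (down_state K j).
Proof. by apply: mxsps_cstr; apply: mxsps_cstl; apply: sps_state_resp. Qed.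

Lemma sps_down_input j : mxsps (down_input K j).
Proof. by apply: mxsps_cstr; apply: mxsps_cstl; apply: sps_input_resp. Qed.

(** The distance of the input from the optimal feedback of the [j]-th downset. *)
Definition deviation z j : 'M[R[i]]_(ddim le m j, q j) :=
  tfeval (down_input K j) z + cmx (gain j) *m tfeval (down_state K j) z.

(** The remainder of the completed squares; its integral is the same for
    all stabilizing [K]. *)
Definition linear_part z : R[i] :=
  \sum_j \tr (cmx ((Fd j)^T *m X j) *m tfeval (down_state K j) z).

(** The cost splits over the columns of the closed loop, and each column is a
    state-feedback problem on one downset, to which the completion of squares
    applies. *)
Lemma h2_density z : z + z^* = 0 ->
  complex.Re (\tr (hadj (tfeval (closed_loop A B C D F K) z)
                   *m tfeval (closed_loop A B C D F K) z))
  = (\sum_j complex.Re (\tr (hadj (deviation z j)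
        *m cmx ((Dd j)^T *m Dd j) *m deviation z j)))
    + complex.Re (linear_part z) *+ 2.
Proof.
move=> zz.
have z_ge0 : 0 <= complex.Re z.
  move: zz; rewrite addcJ => /eqP; rewrite mulf_eq0 pnatr_eq0 /=.
  by move=> /eqP/(@complexI R (complex.Re z) 0) ->.
rewrite trace_hadj_columns (raddf_sum (@complex.Re R : Rcomplex R -> R)).
rewrite /linear_part (raddf_sum (@complex.Re R : Rcomplex R -> R)).
rewrite -sumrMnl -big_split; apply: eq_bigr => j _ /=.
set S := tfeval (down_state K j) z; set U := tfeval (down_input K j) z.
have Sval := mxsps_val (@sps_down_state j) z_ge0.
have Uval := mxsps_val (@sps_down_input j) z_ge0.
have zS : z *: S = cmx (Ad j) *m S + cmx (Fd j) + cmx (Bd j) *m U.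
  rewrite -(tfevalE (mxratval_var Sval)) s_down_state; apply: tfevalE.
  by repeat apply: mxratvalD; try apply: mxratvalM; try apply: mxratval_cst.
have GE : tfeval (closed_loop A B C D F K) z *m cmx (Eq j)
    = cmx (Cd j) *m S + cmx (Dd j) *m U.
  transitivity (tfeval (closed_loop A B C D F K *m cstmx (Eq j)) z).
    symmetry; apply: tfevalE; apply: mxratvalM (mxratval_cst _ _).
    exact: mxsps_val sps_closed_loop z_ge0.
  rewrite closed_loop_column; apply: tfevalE.
  by apply: mxratvalD; apply: mxratvalM => //; apply: mxratval_cst.
have [Xsym _] := Xpos j.
have := lqr_identity (posdef_down j) Xsym (Xric j) (down_CD0 j) zz zS.
rewrite -GE => ->; rewrite !mxtraceD !(raddfD (@complex.Re R : Rcomplex R -> R)) /=.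
rewrite -addrA; congr (_ + _).
rewrite -[hadj S *m _ *m _]mulmxA hadj_cmx.
have -> : \tr (hadj S *m (cmx (X j) *m cmx (Fd j)))
    = (\tr (cmx (Fd j)^T *m cmx (X j) *m S))^*.
  by rewrite -mxtrace_hadj !hadjM !hadj_cmx Xsym trmxK.
rewrite -map_mxM mulr2n; congr (_ + _).
by case: (\tr _).
Qed.

End OneController.

Local Notation Ks := (Kstar A B D X).

Lemma down_input_Kstar j :
  down_input Ks j + cstmx (gain j) *m down_state Ks j = 0.
Proof.
have [Y TY UY] := state_resp_tallE D X le_poset Ainc Binc j.
have Fj : cstmx F *m cstmx (Eq j) = tallE ratfun n j *m cstmx (submxblock F j j).
  by rewrite -cstmxM block_diagonal_tallE // cstmxM cst_tallE.
rewrite /down_input /down_state /input_resp /state_resp.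
rewrite -(mulmxA (cstmx (Em j)^T)) -(mulmxA (cstmx (En j)^T)).
rewrite -(mulmxA _ (cstmx F)) -(mulmxA _ (cstmx F)) Fj.
rewrite (mulmxA _ (tallE ratfun n j)) (mulmxA (invmx _) (tallE ratfun n j)) TY UY.
rewrite -!cst_downE mulNmx mulmxN -!(mulmxA (cstmx (downE _ _ _ _))).
rewrite !(mulmxA (cstmx _^T)) -!cstmxM !downE_tr_id cstmx1 !mul1mx.
by rewrite cstmx1 mul1mx mulmxA addNr.
Qed.

Lemma deviation_Kstar z j : stabilizing A B Ks -> 0 <= complex.Re z ->
  deviation Ks z j = 0.
Proof.
move=> Kstab z_ge0; rewrite /deviation.
rewrite -(tfevalE (mxratvalD (mxsps_val (@sps_down_input Ks Kstab j) z_ge0)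
  (mxratvalM (mxratval_cst z (gain j)) (mxsps_val (@sps_down_state Ks Kstab j) z_ge0)))).
rewrite down_input_Kstar -(cstmx0 _ _) (tfevalE (mxratval_cst z _)).
exact: map_mx0.
Qed.

(** [linear_part] before evaluation, as a linear function of the state response. *)
Definition linear_form (S : 'M[ratfun]_(\sum_i n i, \sum_i q i)) : ratfun :=
  \sum_j \tr (cstmx ((Fd j)^T *m X j) *m (cstmx (En j)^T *m S *m cstmx (Eq j))).

Lemma linear_form_sps S : mxsps S -> sps (linear_form S).
Proof.
move=> Ssps; apply: sps_sum => j; apply: sps_sum => i.
by apply: mxsps_cstl; apply: mxsps_cstr; apply: mxsps_cstl.
Qed.

Lemma linear_formZ a S : linear_form (a *: S) = a * linear_form S.
Proof.
rewrite /linear_form mulr_sumr; apply: eq_bigr => j _.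
by rewrite -scalemxAr -scalemxAl -scalemxAr mxtraceZ.
Qed.

Lemma linear_formB S S' : linear_form (S - S') = linear_form S - linear_form S'.
Proof.
rewrite /linear_form -sumrB; apply: eq_bigr => j _.
by rewrite mulmxBr mulmxBl mulmxBr raddfB.
Qed.

Lemma linear_form_resp K z : stabilizing A B K -> 0 <= complex.Re z ->
  ratval z (linear_form (state_resp K)) (linear_part K z).
Proof.
move=> Kstab z_ge0; apply: ratval_sum => j; apply: ratval_sum => i.
apply: mxratvalM; first exact: mxratval_cst.
exact: (mxsps_val (@sps_down_state K Kstab j) z_ge0).
Qed.

Lemma sps_linear_form_sub K K' : stabilizing A B K -> stabilizing A B K' ->
  sps (linear_form (state_resp K - state_resp K')).
Proof.
move=> Kst Kst'; apply: linear_form_sps; apply: mxspsD.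
  exact: sps_state_resp.
by apply: mxspsN; apply: sps_state_resp.
Qed.

Lemma rateval_linear_form_sub K K' (w : R) :
  stabilizing A B K -> stabilizing A B K' ->
  rateval (linear_form (state_resp K - state_resp K')) (Complex 0 w)
    = linear_part K (Complex 0 w) - linear_part K' (Complex 0 w).
Proof.
move=> Kst Kst'; apply: ratvalE; rewrite linear_formB.
by apply: ratvalB; apply: linear_form_resp.
Qed.

(** The difference [S - S'] of two responses satisfies the plant equation without
    the disturbance term, so that [s (S - S')] is strictly proper as well. *)
Lemma zero_mean_linear_part K K' : stabilizing A B K -> stabilizing A B K' ->
  zero_mean (fun w : R =>
    linear_part K (Complex 0 w) - linear_part K' (Complex 0 w)).
Proof.
move=> Kst Kst'; pose f := linear_form (state_resp K - state_resp K').
have sD : ratvar *: (state_resp K - state_resp K')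
    = cstmx A *m (state_resp K - state_resp K')
      + cstmx B *m (input_resp K - input_resp K').
  have := s_state_resp Kst; have := s_state_resp Kst'.
  move: (state_resp K) (state_resp K') (input_resp K) (input_resp K') => S S' U U'.
  by move=> e' e; rewrite scalerBr e e' !mulmxBr subr_common.
have sf : sps (ratvar * f).
  have -> : ratvar * f = linear_form (ratvar *: (state_resp K - state_resp K')).
    by rewrite linear_formZ.
  rewrite sD; apply: linear_form_sps.
  apply: mxspsD; apply: mxsps_cstl; apply: mxspsD.
  - exact: sps_state_resp.
  - by apply: mxspsN; apply: sps_state_resp.
  - exact: sps_input_resp.
  - by apply: mxspsN; apply: sps_input_resp.
apply: zero_mean_ext (sps_zero_mean (sps_linear_form_sub Kst Kst') sf) => w.
exact: rateval_linear_form_sub.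
Qed.

Lemma Kstar_optimal K : incidence le K -> stabilizing A B K ->
  stabilizing A B Ks ->
  (h2norm_sq (closed_loop A B C D F Ks) <= h2norm_sq (closed_loop A B C D F K))%E.
Proof.
move=> Kinc Kst Ksst.
have Ksinc : incidence le Ks by exact: incidence_Kstar.
rewrite /h2norm_sq; apply: lee_wpmul2l.
  by rewrite lee_fin invr_ge0 mulr_ge0 // pi_ge0.
pose G K (w : R) := tfeval (closed_loop A B C D F K) (Complex 0 w).
pose dens K w : R := complex.Re (\tr (hadj (G K w) *m G K w)).
have iw (w : R) : (Complex 0 w : R[i]) + (Complex 0 w)^* = 0.
  by rewrite addcJ /= mulr0.
have iw0 (w : R) : 0 <= complex.Re (Complex 0 w) by [].
have [g [dg [g1 _] [g2 _]]] := zero_mean_linear_part Kst Ksst.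
apply: (@le_integral_zero_mean _ (dens Ks) (dens K)
  (fun w => complex.Re (linear_part K (Complex 0 w) - linear_part Ks (Complex 0 w)) * 2)
  (fun w => complex.Re (g w) * 2)).
- by apply: continuous_h2_density; apply: sps_closed_loop.
- by apply: continuous_h2_density; apply: sps_closed_loop.
- have [g' /cder_continuous[c1 _]] := sps_cder (sps_linear_form_sub Kst Ksst).
  under eq_fun do rewrite -rateval_linear_form_sub //.
  by move=> w; apply: cvgM; [exact: c1|exact: cvg_cst].
- by move=> w; apply: Re_trace_hadj_ge0.
- by move=> w; apply: Re_trace_hadj_ge0.
- move=> w; have [d1 _] := dg w.
  apply: (is_derive_eq (is_deriveM d1 (is_derive_cst (2 : R) w 1))).
  by rewrite /GRing.scale /= mulr0 add0r mulrC.
- by rewrite -[0](mul0r 2); apply: cvgM => //; exact: cvg_cst.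
- by rewrite -[0](mul0r 2); apply: cvgM => //; exact: cvg_cst.
move=> w.
have e1 : dens Ks w = complex.Re (linear_part Ks (Complex 0 w)) *+ 2.
  apply: (etrans (h2_density Ksinc Ksst (iw w))).
  rewrite big1 ?add0r // => j _.
  by rewrite (deviation_Kstar j Ksst (iw0 w)) mulmx0 mxtrace0.
have e2 : complex.Re (linear_part K (Complex 0 w)) *+ 2 <= dens K w.
  rewrite /dens (h2_density Kinc Kst (iw w)) lerDr; apply: sumr_ge0 => j _.
  have := mxtrace_posdef_ge0 (deviation K (Complex 0 w) j) (posdef_down j).
  by rewrite lecE => /andP[].
rewrite e1; apply: le_trans e2.
move: (linear_part _ _) (linear_part _ _) => [a1 a2] [b1 b2] /=.
by rewrite mulrBl !mulr_natr addrC subrK.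
Qed.

End Cost.

Theorem theorem3 (R : realType) (p : nat) (le : rel 'I_p)
    (n m q : 'I_p -> nat) (l : nat)
    (A : 'M[R]_(\sum_i n i)) (B : 'M[R]_(\sum_i n i, \sum_i m i))
    (C : 'M[R]_(l, \sum_i n i)) (D : 'M[R]_(l, \sum_i m i))
    (F : 'M[R]_(\sum_i n i, \sum_i q i))
    (X : forall j : 'I_p, 'M[R]_(ddim le n j)) :
  poset_on le ->
  incidence le A -> incidence le B ->
  C^T *m D = 0 -> posdef (D^T *m D) ->
  block_diagonal F -> \rank F = (\sum_i q i)%N ->
  (forall i, stabilizable (submxblock A i i) (submxblock B i i)) ->
  (forall j, posdef (X j) /\ riccati_solution A B C D (X j)) ->
  let Ks := Kstar A B D X in
  let cost K := h2norm_sq (closed_loop A B C D F K) in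
  [/\ forall j (Y : 'M[R]_(ddim le n j)),
        posdef Y -> riccati_solution A B C D Y -> Y = X j,
      [/\ proper_tf Ks, incidence le Ks & stabilizing A B Ks]
    & forall K : 'M[{fraction {poly R}}]_(\sum_i m i, \sum_i n i),
        proper_tf K -> incidence le K -> stabilizing A B K ->
        (cost Ks <= cost K)%E].
Proof.
move=> le_poset Ainc Binc CD DDpos Fdiag _ stab Xsol Ks cost.
have hur j (Y : 'M[R]_(ddim le n j)) : posdef Y -> riccati_solution A B C D Y ->
    hurwitz (down_block le A j - down_block le B j
      *m care_gain (down_block le B j) (down_cols le D j) Y).
  move=> Ypos Yric; apply: (care_hurwitz (posdef_down le DDpos j) Ypos Yric).
  exact: pbh_down_block.
have Ksstab : stabilizing A B Ks.
  by apply: stabilizing_Kstar => // j; have [Xpos Xric] := Xsol j; apply: hur.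
split.
- move=> j Y Ypos Yric; have [Xpos Xric] := Xsol j.
  have [Ysym _] := Ypos; have [Xsym _] := Xpos.
  apply/eqP; rewrite -subr_eq0; apply/eqP.
  apply: (sylvester_hurwitz (hur j _ Xpos Xric) (hur j _ Ypos Yric)).
  exact: (care_sub Ysym Xsym Yric Xric).
- split=> //; [exact: proper_ss_tf|exact: incidence_Kstar].
move=> K _ Kinc Kstab.
by apply: Kstar_optimal => // j; have [] := Xsol j.
Qed.
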